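(* Let $d\ge 2$ and let $\varepsilon\in(0,1]$. Let $X$ be a fixed (deterministic) everywhere percolating subgraph of $\mathbb{Z}^d$, and let $Y=X\cup\omega$, where $\omega$ is an $\varepsilon$-Bernoulli percolation on $\mathbb{Z}^d$. Then the following hold. (i) The graph $(\mathbb{Z}^d,Y)$ is connected almost surely. (ii) The critical parameter for Bernoulli percolation on $Y$ satisfies $p_c(Y)<1$ almost surely. (iii) $Y$ percolates in the upper half-space $\{0,1,2,\ldots\}\times\mathbb{Z}^{d-1}$ almost surely. (iv) There exists an integer $L=L(\varepsilon,d)$, depending only on $\varepsilon$ and $d$ (not on $X$), such that $Y$ percolates in the slab $\mathbb{Z}^2\times\{0,\ldots,L\}^{d-2}$ almost surely. (v) For every $p<1$, there exists an integer $n\ge 1$ such that the percolation process $Y^{(n)}$ stochastically dominates a $p$-Bernoulli percolation on $\mathbb{Z}^d$.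
   Context: Let $\mathbb{E}^d$ be the set of nearest-neighbour edges of the hypercubic lattice $\mathbb{Z}^d$. A subgraph of $\mathbb{Z}^d$ is a set of edges $X\subset\mathbb{E}^d$, identified with the graph $(\mathbb{Z}^d,X)$ (its vertex set is always all of $\mathbb{Z}^d$). Two vertices are $X$-connected inside $S\subset\mathbb{Z}^d$ if they are joined by a path of edges of $X$ all of whose vertices lie in $S$. The subgraph $X$ is everywhere percolating if all connected components of $(\mathbb{Z}^d,X)$ are infinite. $X$ percolates in $S\subset\mathbb{Z}^d$ if the graph induced by $X$ on $S$ contains an infinite connected component. A $p$-Bernoulli percolation (or $p$-percolation) on $\mathbb{Z}^d$ is the random subgraph $\omega\subset\mathbb{E}^d$ in which each edge of $\mathbb{E}^d$ belongs to $\omega$ with probability $p$, independently of the others. For a subgraph $Y$, $p_c(Y)$ is the critical parameter of Bernoulli bond percolation on $Y$: the infimum of those $q\in[0,1]$ such that keeping each edge of $Y$ independently with probability $q$ yields an infinite connected component with positive probability (here conditionally on $Y$). For $r>0$, $\Lambda_r=[-r,r]^d\cap\mathbb{Z}^d$. For an integer $n\ge1$, the renormalized process $Y^{(n)}$ is the random subset of $\mathbb{E}^d$ defined by: the edge $\{x,y\}\in\mathbb{E}^d$ belongs to $Y^{(n)}$ if and only if $2nx$ is $Y$-connected to $2ny$ inside $n(x+y)+\Lambda_{2n}$. A random subset $Z$ of $\mathbb{E}^d$ stochastically dominates a random subset $Z'$ if there is a coupling of the two under which $Z'\subset Z$ almost surely. *)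

(* Defs.v *)
From HB Require Import structures.
From mathcomp Require Import all_boot all_order all_algebra finmap.
From mathcomp Require Import all_classical all_reals all_analysis.

Set Implicit Arguments.
Unset Strict Implicit.
Unset Printing Implicit Defensive.

Import Order.TTheory GRing.Theory Num.Theory.

Local Open Scope classical_set_scope.
Local Open Scope ring_scope.

Definition vertex (d : nat) := 'rV[int]_d.

(* The undirected nearest-neighbour edge {x, x + e_i} is encoded, uniquely, by
   its lower endpoint x and its direction i. *)
Definition edge (d : nat) := (vertex d * 'I_d)%type.

Definition endpoint1 (d : nat) (e : edge d) : vertex d := e.1.
Definition endpoint2 (d : nat) (e : edge d) : vertex d := e.1 + delta_mx 0 e.2.

Definition adjacent (d : nat) (X : set (edge d)) (x y : vertex d) : Prop :=
  exists2 e : edge d, X e &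
    (x = endpoint1 e /\ y = endpoint2 e) \/ (x = endpoint2 e /\ y = endpoint1 e).

Definition connected_in (d : nat) (X : set (edge d)) (S : set (vertex d))
    (x y : vertex d) : Prop :=
  exists s : seq (vertex d),
    [/\ path (fun u v => `[< adjacent X u v >]) x s,
        last x s = y
      & forall z, z \in x :: s -> S z].

Definition cluster (d : nat) (X : set (edge d)) (S : set (vertex d))
    (x : vertex d) : set (vertex d) :=
  [set y | connected_in X S x y].

Definition everywhere_percolating (d : nat) (X : set (edge d)) : Prop :=
  forall x, infinite_set (cluster X setT x).

Definition percolates_in (d : nat) (X : set (edge d)) (S : set (vertex d)) :
    Prop :=
  exists2 x, S x & infinite_set (cluster X S x).

Definition connected_graph (d : nat) (X : set (edge d)) : Prop :=
  forall x y, connected_in X setT x y.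

Definition box (d r : nat) : set (vertex d) :=
  [set z : vertex d | forall j, `|z 0 j| <= r%:Z].

Definition upper_half_space (d : nat) : set (vertex d) :=
  [set x : vertex d | forall i : 'I_d, i = 0%N :> nat -> 0 <= x 0 i].

Definition slab (d L : nat) : set (vertex d) :=
  [set x : vertex d | forall i : 'I_d, (2 <= i)%N -> 0 <= x 0 i <= L%:Z].

Arguments upper_half_space d _ : clear implicits.
Arguments slab d L _ : clear implicits.

Definition renormalized (d n : nat) (Y : set (edge d)) : set (edge d) :=
  [set e : edge d | let x := endpoint1 e in let y := endpoint2 e in
    connected_in Y [set z : vertex d | box (2 * n) (z - (x + y) *+ n)]
      (x *+ (2 * n)) (y *+ (2 * n))].

(* Measurability of a random edge set for the product sigma-algebra. *)
Definition random_subgraph (d : nat) (disp : measure_display)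
    (T : measurableType disp) (Z : T -> set (edge d)) : Prop :=
  forall e, measurable [set w | Z w e].

Definition mutually_independent (R : realType) (disp : measure_display)
    (T : measurableType disp) (P : probability T R) (I : choiceType)
    (E : I -> set T) : Prop :=
  forall J : {fset I},
    P (\bigcap_(i in [set` J]) E i) = (\prod_(i <- J) P (E i))%E.

Definition bernoulli_percolation (R : realType) (d : nat)
    (disp : measure_display) (T : measurableType disp) (P : probability T R)
    (p : R) (omega : T -> set (edge d)) : Prop :=
  [/\ random_subgraph omega,
      forall e, P [set w | omega w e] = p%:E
    & mutually_independent P (fun e => [set w | omega w e])].

(* The law of a Bernoulli percolation is determined by q, so the choice of the
   probability space carrying it is immaterial; it is independent of the space
   on which a random G may live, which makes [p_c] conditional on G. *)
Definition percolates_at (R : realType) (d : nat) (G : set (edge d)) (q : R) :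
    Prop :=
  exists (disp : measure_display) (T : measurableType disp)
    (P : probability T R) (eta : T -> set (edge d)),
    bernoulli_percolation P q eta /\
    (0 < P [set w | percolates_in (G `&` eta w) setT])%E.

(* Extended-real infimum: the infimum of the empty set is +oo, whereas the
   real-valued [inf] would return 0. *)
Definition p_c (R : realType) (d : nat) (G : set (edge d)) : \bar R :=
  ereal_inf [set q%:E | q in [set q : R | 0 <= q <= 1 /\ percolates_at G q]].

Definition cylinders (d : nat) : set (set (set (edge d))) :=
  range (fun e : edge d => [set S : set (edge d) | S e]).

Arguments cylinders d _ : clear implicits.

Definition same_law (R : realType) (d : nat)
    (disp1 disp2 : measure_display) (T1 : measurableType disp1)
    (T2 : measurableType disp2)
    (P1 : probability T1 R) (Z1 : T1 -> set (edge d))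
    (P2 : probability T2 R) (Z2 : T2 -> set (edge d)) : Prop :=
  [/\ random_subgraph Z1, random_subgraph Z2
    & forall A, <<s cylinders d >> A -> P1 (Z1 @^-1` A) = P2 (Z2 @^-1` A)].

Definition stochastically_dominates (R : realType) (d : nat)
    (disp1 disp2 : measure_display) (T1 : measurableType disp1)
    (T2 : measurableType disp2)
    (P1 : probability T1 R) (Z1 : T1 -> set (edge d))
    (P2 : probability T2 R) (Z2 : T2 -> set (edge d)) : Prop :=
  exists (disp : measure_display) (T : measurableType disp)
    (P : probability T R) (Z Z' : T -> set (edge d)),
    [/\ same_law P Z P1 Z1, same_law P Z' P2 Z2
      & {ae P, forall w, Z' w `<=` Z w}].

(* Main.v *)
Require Import Defs.
From HB Require Import structures.
From mathcomp Require Import all_boot all_order all_algebra finmap.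
From mathcomp Require Import all_classical all_reals all_analysis.
From mathcomp Require Import zify ring lra.

(** Everything rests on one local estimate, [ball_connected]: for n large,
uniformly in X and in the centre c, with probability close to 1 the graph
X `|` omega joins any two vertices of the ball of radius n around c inside
the ball of radius 2n.  All X-clusters are infinite, so the X-cluster of a
vertex crosses every sphere between the vertex and the boundary of the big
ball.  Cut the shell between the radii 2n and n into k annuli of width k,
where n = k * k, and add the edges of omega annulus after annulus, from the
outside to the inside.  As d >= 2, each sphere is connected, hence a cluster
that meets a sphere without containing it has an edge of this sphere on its
boundary; an annulus thus offers k distinct edges through which a given
cluster can meet another one, and since these edges are independent of what
was added before, the cluster stays isolated with probability at most
(1 - eps) ^ k ([merged_prob]).  If no cluster stays isolated, the smallest
size of a cluster doubles in each annulus, which cannot go on for k rounds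
because 2 ^ k exceeds the number of vertices of the ball; so at some round a
single cluster is left ([merged_connected]).  The union bound over rounds and
vertices costs a polynomial in k against (1 - eps) ^ k.

Almost sure connectedness follows by letting n tend to infinity.

The other claims come from a comparison with independent percolation
([coupling]).  The renormalized edge e depends on omega in a ball of radius 2n
only, but the balls of neighbouring edges overlap.  Colour the edges with
finitely many colours so that two edges of one colour have disjoint balls, and
write omega as a union of independent percolations, one for each colour, with
a smaller density eps' that depends on eps and d alone.  If the edge e may use
only the percolation of its own colour, the events become independent, they
are contained in the original ones because connectivity is increasing in
omega, and by the local estimate for eps' their probability is close to 1.
Deleting renormalized edges with an independent randomization brings the
density down to exactly p.  This proves the stochastic domination, and no
theorem on the domination of dependent fields is needed.

The same coupling handles (X `|` omega) `&` eta, where eta is an independent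
Bernoulli percolation of density q < 1 close to 1: a good block must in
addition have all its edges in eta.  For p = 15/16, a Peierls argument gives
an infinite cluster of good renormalized edges in a quadrant of a coordinate
plane ([quadrant_percolation]), so (X `|` omega) `&` eta percolates almost
surely in a set which lies both in the upper half-space and in a slab of width
4n ([joint_percolation_percolates]).  By Fubini's theorem, for almost every
omega the percolation eta on X `|` omega has an infinite cluster; hence
p_c <= q, and the two other claims follow by forgetting eta. *)

Set Implicit Arguments.
Unset Strict Implicit.
Unset Printing Implicit Defensive.

Import Order.TTheory GRing.Theory Num.Theory.
(* [adjacent] is also the name of a lemma on sequences. *)
Import Defs.

Local Open Scope classical_set_scope.
Local Open Scope ring_scope.

(** * Independence of events indexed by a set *)

Definition cyl (I : Type) : set (set (set I)) :=
  range (fun i : I => [set S : set I | S i]).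
Arguments cyl I _ : clear implicits.

(** The subsets of I with the sigma-algebra generated by the membership
    events.  Events about a random subset of I are preimages of measurable
    sets of this type, and events that depend only on the part of the random
    set in G are preimages under w |-> Z w `&` G. *)
Definition setspace (I : Type) := g_sigma_algebraType (cyl I).
HB.instance Definition _ (I : Type) := Measurable.on (setspace I).

Lemma measurable_cyl (I : Type) (i : I) :
  measurable ([set S | S i] : set (setspace I)).
Proof. by apply: sub_sigma_algebra; exists i. Qed.

Definition random_set (I : Type) (disp : measure_display)
    (T : measurableType disp) (Z : T -> set I) : Prop :=
  forall i, measurable [set w | Z w i].

Lemma random_set_id (I : Type) : random_set (fun S : setspace I => S).
Proof. by move=> i; exact: measurable_cyl. Qed.

Lemma random_set_preimage (I : Type) (disp : measure_display)
    (T : measurableType disp) (Z : T -> set I) (A : set (setspace I)) :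
  random_set Z -> measurable A -> measurable (Z @^-1` A).
Proof.
move=> mZ; move: A; apply: smallest_sub.
  split; first by rewrite preimage_set0.
  - by move=> B mB; rewrite setTD preimage_setC; exact: measurableC.
  - by move=> F mF; rewrite preimage_bigcup; exact: bigcup_measurable.
by move=> _ [i _ <-]; exact: mZ.
Qed.

Lemma random_set_setI (I : Type) (disp : measure_display)
    (T : measurableType disp) (Z : T -> set I) (G : set I) :
  random_set Z -> random_set (fun w => Z w `&` G).
Proof.
move=> mZ i; case: (pselect (G i)) => Gi.
  rewrite (_ : [set _ | _] = [set w | Z w i]) //.
  by apply/seteqP; split=> w //= [].
rewrite (_ : [set _ | _] = set0) //.
by apply/seteqP; split=> w //= [].
Qed.

Definition supersets (I : choiceType) (J : {fset I}) : set (setspace I) :=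
  [set S | forall i, i \in J -> S i].

Definition superset_events (I : choiceType) : set (set (setspace I)) :=
  range (@supersets I).
Arguments superset_events I _ : clear implicits.

Lemma supersets_bigcap (I : choiceType) (J : {fset I}) T (Z : T -> set I) :
  Z @^-1` supersets J = \bigcap_(i in [set` J]) [set w | Z w i].
Proof. by apply/seteqP; split. Qed.

Lemma measurable_supersets (I : choiceType) (J : {fset I}) :
  measurable (supersets J).
Proof.
rewrite -[supersets J]/(id @^-1` supersets J) supersets_bigcap.
apply: fin_bigcap_measurable => [|i _]; first exact: finite_fset.
exact: measurable_cyl.
Qed.

Lemma superset_events_setI (I : choiceType) : setI_closed (superset_events I).
Proof.
move=> _ _ [J _ <-] [K _ <-]; exists (J `|` K)%fset => //.
apply/seteqP; split => S.
  by move=> SJK; split=> i iJ; apply: SJK; rewrite inE iJ ?orbT.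
by move=> [SJ SK] i; rewrite inE => /orP[]; [exact: SJ|exact: SK].
Qed.

Lemma superset_events_gen (I : choiceType) :
  @measurable _ (setspace I) = <<s superset_events I >>.
Proof.
apply/seteqP; split.
  apply: smallest_sub; first exact: smallest_sigma_algebra.
  move=> _ [i _ <-]; apply: sub_sigma_algebra; exists [fset i]%fset => //.
  apply/seteqP; split=> S /=; first by apply; rewrite inE.
  by move=> Si j; rewrite inE => /eqP ->.
apply: smallest_sub; first exact: sigma_algebra_measurable.
by move=> _ [J _ <-]; exact: measurable_supersets.
Qed.

(** Dynkin's induction: the events asking the random set to contain a
    given finite set form a pi-system that generates the sigma-algebra. *)
Lemma setspace_ind (I : choiceType) (C : set (set (setspace I))) :
  (forall J : {fset I}, C (supersets J)) ->
  (forall S, measurable S -> C S -> C (~` S)) ->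
  (forall F : (set (setspace I))^nat, (forall n, measurable (F n)) ->
    trivIset setT F -> (forall n, C (F n)) -> C (\bigcup_k F k)) ->
  forall S, measurable S -> C S.
Proof.
move=> CJ CC CU S; rewrite superset_events_gen.
apply: dynkin_induction => //.
- exact: superset_events_gen.
- exact: superset_events_setI.
- have -> : [set: setspace I] = supersets fset0; last exact: CJ.
  by apply/seteqP; split=> // S' _ i; rewrite inE.
- by move=> _ [J _ <-].
Qed.

Section independence.
Variables (R : realType) (I : choiceType).
Implicit Types (disp : measure_display).

(** Independence and the marginals fix the probability of every finite
    intersection, hence the whole law. *)
Lemma indep_law disp1 (T1 : measurableType disp1) (P1 : probability T1 R)
    (Z1 : T1 -> set I) disp2 (T2 : measurableType disp2)
    (P2 : probability T2 R) (Z2 : T2 -> set I) :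
  random_set Z1 -> random_set Z2 ->
  mutually_independent P1 (fun i => [set w | Z1 w i]) ->
  mutually_independent P2 (fun i => [set w | Z2 w i]) ->
  (forall i, P1 [set w | Z1 w i] = P2 [set w | Z2 w i]) ->
  forall A : set (setspace I), measurable A -> P1 (Z1 @^-1` A) = P2 (Z2 @^-1` A).
Proof.
move=> m1 m2 i1 i2 e12; apply: setspace_ind.
- move=> J; rewrite !supersets_bigcap i1 i2.
  by apply: eq_bigr => i _.
- move=> S mS e.
  have mS1 := random_set_preimage m1 mS.
  have mS2 := random_set_preimage m2 mS.
  by rewrite 2!preimage_setC (probability_setC P1 mS1) (probability_setC P2 mS2) e.
- move=> F mF tF e.
  have mF1 n : setT n -> measurable (Z1 @^-1` F n).
    by move=> _; exact: random_set_preimage.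
  have mF2 n : setT n -> measurable (Z2 @^-1` F n).
    by move=> _; exact: random_set_preimage.
  have tF1 : trivIset setT (fun n => Z1 @^-1` F n).
    by move=> i j _ _ [w [Fi Fj]]; apply: tF => //; exists (Z1 w).
  have tF2 : trivIset setT (fun n => Z2 @^-1` F n).
    by move=> i j _ _ [w [Fi Fj]]; apply: tF => //; exists (Z2 w).
  rewrite 2!preimage_bigcup (measure_bigcup P1 setT _ mF1 tF1) (measure_bigcup P2 setT _ mF2 tF2).
  by apply: eq_eseriesr => n _; exact: e.
Qed.

Variables (disp : measure_display) (T : measurableType disp)
  (P : probability T R) (Z : T -> set I).
Hypotheses (mZ : random_set Z)
  (iZ : mutually_independent P (fun i => [set w | Z w i])).

Lemma indep_supersets (G1 G2 : set I) (J1 J2 : {fset I}) :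
  G1 `&` G2 = set0 ->
  P (((fun w => Z w `&` G1) @^-1` supersets J1) `&`
     ((fun w => Z w `&` G2) @^-1` supersets J2)) =
  (P ((fun w => Z w `&` G1) @^-1` supersets J1) *
   P ((fun w => Z w `&` G2) @^-1` supersets J2))%E.
Proof.
move=> G12.
have sup0 (G : set I) (J : {fset I}) : ~ [set` J] `<=` G ->
    (fun w => Z w `&` G) @^-1` supersets J = set0.
  move=> nG; apply/seteqP; split=> w //= sJ; apply: nG => i iJ.
  by case: (sJ i iJ).
have sup1 (G : set I) (J : {fset I}) : [set` J] `<=` G ->
    (fun w => Z w `&` G) @^-1` supersets J = Z @^-1` supersets J.
  by move=> JG; apply/seteqP; split=> w sJ i iJ; [case: (sJ i iJ)|
    split; [exact: sJ|exact: JG]].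
have [J1G|nJ1G] := pselect ([set` J1] `<=` G1); last first.
  by rewrite (sup0 _ _ nJ1G) set0I measure0 mul0e.
have [J2G|nJ2G] := pselect ([set` J2] `<=` G2); last first.
  by rewrite (sup0 _ _ nJ2G) setI0 measure0 mule0.
rewrite !sup1// -preimage_setI.
have -> : supersets J1 `&` supersets J2 = supersets (J1 `|` J2)%fset.
  apply/seteqP; split=> S.
    by move=> [SJ SK] i; rewrite inE => /orP[]; [exact: SJ|exact: SK].
  by move=> SJK; split=> i iJ; apply: SJK; rewrite inE iJ ?orbT.
rewrite !supersets_bigcap !iZ.
have J12 : [disjoint J1 & J2]%fset.
  apply/fdisjointP => i iJ1; apply/negP => iJ2.
  suff: set0 i by [].
  by rewrite -G12; split; [exact: J1G|exact: J2G].
rewrite -big_cat; apply: perm_big; apply: uniq_perm.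
- exact: fset_uniq.
- rewrite cat_uniq !fset_uniq andbT /=; apply/hasPn => i iJ2.
  by apply/negP => iJ1; move/fdisjointP: J12 => /(_ i iJ1); rewrite iJ2.
- by move=> i; rewrite inE mem_cat.
Qed.

(** One half of the passage from generators to sigma-algebras; it is used
    once for each of the two blocks. *)
Lemma indep_ext (B : set T) (G : set I) : measurable B ->
  (forall J, P (((fun w => Z w `&` G) @^-1` supersets J) `&` B) =
     (P ((fun w => Z w `&` G) @^-1` supersets J) * P B)%E) ->
  forall A : set (setspace I), measurable A ->
  P (((fun w => Z w `&` G) @^-1` A) `&` B) =
    (P ((fun w => Z w `&` G) @^-1` A) * P B)%E.
Proof.
move=> mB eB; have mG := random_set_setI G mZ.
apply: setspace_ind => //.
- move=> S mS e.
  pose X := (fun w => Z w `&` G) @^-1` S.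
  change (P (~` X `&` B) = P (~` X) * P B)%E.
  have mX : measurable X by exact: (random_set_preimage mG mS).
  have {}e : P (X `&` B) = (P X * P B)%E := e.
  move: (X) mX e => {S mS X} X mX e; rewrite (probability_setC P mX).
  have fB : P B \is a fin_num by exact: fin_num_measure.
  have fX : P X \is a fin_num by exact: fin_num_measure.
  have -> : P (~` X `&` B) = (P B - P (X `&` B))%E.
    rewrite setIC -setDE measureD //; first by rewrite (setIC B).
    by rewrite ltey_eq fB.
  by rewrite e muleBl ?mul1e // fin_num_adde_defl.
- move=> F mF tF e.
  have mF1 n : setT n -> measurable ((fun w => Z w `&` G) @^-1` F n).
    by move=> _; exact: random_set_preimage.
  have tF1 : trivIset setT (fun n => (fun w => Z w `&` G) @^-1` F n).
    by move=> i j _ _ [w [Fi Fj]]; apply: tF => //; exists (Z w `&` G).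
  have mF2 n : setT n -> measurable ((fun w => Z w `&` G) @^-1` F n `&` B).
    by move=> /mF1 mFn; exact: measurableI.
  have tF2 : trivIset setT (fun n => (fun w => Z w `&` G) @^-1` F n `&` B).
    move=> i j _ _ [w [[Fi _] [Fj _]]].
    by apply: tF => //; exists (Z w `&` G).
  rewrite preimage_bigcup setI_bigcupl.
  rewrite (measure_bigcup P setT _ mF1 tF1) (measure_bigcup P setT _ mF2 tF2).
  have fB : P B \is a fin_num by exact: fin_num_measure.
  rewrite muleC -[in RHS](fineK fB) -nneseriesZl //.
  by apply: eq_eseriesr => n _; rewrite (fineK fB) muleC; exact: e.
Qed.

Lemma indep_two_blocks (G1 G2 : set I) (A1 A2 : set (setspace I)) :
  G1 `&` G2 = set0 -> measurable A1 -> measurable A2 ->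
  P (((fun w => Z w `&` G1) @^-1` A1) `&` ((fun w => Z w `&` G2) @^-1` A2)) =
  (P ((fun w => Z w `&` G1) @^-1` A1) * P ((fun w => Z w `&` G2) @^-1` A2))%E.
Proof.
move=> G12 mA1 mA2.
apply: indep_ext => //.
  exact: random_set_preimage (random_set_setI G2 mZ) mA2.
move=> J; rewrite setIC muleC.
apply: indep_ext => //.
  exact: random_set_preimage (random_set_setI G1 mZ) (measurable_supersets J).
by move=> J'; apply: indep_supersets; rewrite setIC.
Qed.

(** Disjoint blocks of independent variables are independent.  A finite
    family of blocks is split off one block at a time, the remaining blocks
    forming a single event of their union. *)
Lemma indep_blocks (K : choiceType) (G : K -> set I)
    (A : K -> set (setspace I)) :
  (forall k l, k != l -> G k `&` G l = set0) ->
  (forall k, measurable (A k)) ->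
  mutually_independent P (fun k => (fun w => Z w `&` G k) @^-1` A k).
Proof.
move=> Gd mA J.
have rI (H : set I) := random_set_setI H (@random_set_id I).
elim/finSet_rect: J => J IH.
have [->|[k kJ]] := fset_0Vmem J.
  by rewrite big_seq_fset0 set_fset0 bigcap_set0 probability_setT.
rewrite (big_fsetD1 k) //= -IH ?fproperD1 //.
pose H := \bigcup_(l in [set` (J `\ k)%fset]) G l.
(* The other blocks, seen as a single event on the union H of their supports. *)
pose B : set (setspace I) :=
  \bigcap_(l in [set` (J `\ k)%fset]) ((fun S : setspace I => S `&` G l) @^-1` A l).
have -> : \bigcap_(l in [set` (J `\ k)%fset]) ((fun w => Z w `&` G l) @^-1` A l) =
    (fun w => Z w `&` H) @^-1` B.
  apply/seteqP; split=> w wA l lJ; have := wA l lJ => /=;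
    by rewrite -setIA (setIidr (@bigcup_sup _ _ l _ G lJ)).
rewrite -indep_two_blocks //; last 2 first.
- rewrite /H setI_bigcupr bigcup0 // => l /=.
  by rewrite !inE => /andP[lk _]; apply: Gd; rewrite eq_sym.
- apply: fin_bigcap_measurable => [|l _]; first exact: finite_fset.
  exact: random_set_preimage.
congr (P _).
apply/seteqP; split=> w.
  move=> wA; split; first exact: wA.
  move=> l /= lJ; have := wA l; rewrite /= -setIA (setIidr (@bigcup_sup _ _ l _ G lJ)).
  by apply; move: lJ; rewrite !inE => /andP[].
move=> [wk wB] l lJ; have [->//|lk] := eqVneq l k.
have lJk : [set` (J `\ k)%fset] l by rewrite /= !inE lk.
have := wB l lJk; rewrite /= -setIA (setIidr (@bigcup_sup _ _ l _ G lJk)).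
exact.
Qed.

End independence.

Lemma mutually_independent_inj (R : realType) (disp : measure_display)
    (T : measurableType disp) (P : probability T R) (I K : choiceType)
    (g : K -> I) (E : I -> set T) :
  injective g -> mutually_independent P E ->
  mutually_independent P (fun k => E (g k)).
Proof.
move=> gI iE J; have := iE [fset g k | k in J]%fset.
rewrite big_imfset /=; last by move=> i j _ _; exact: gI.
move=> <-; congr (P _); apply/seteqP; split=> x xJ.
  by move=> _ /= /imfsetP[i /= iJ ->]; exact: xJ.
by move=> i iJ; apply: xJ => /=; apply/imfsetP; exists i.
Qed.

(** * Existence of independent events with prescribed probabilities *)

Section nested_intervals.
Variables (R : realType) (p : nat -> R).
Hypothesis p01 : forall n, 0 <= p n <= 1.

Fixpoint cell_len (s : seq bool) : R :=
  if s is b :: s' then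
    cell_len s' * (if b then p (size s') else 1 - p (size s'))
  else 1.

Fixpoint cell_left (s : seq bool) : R :=
  if s is b :: s' then
    cell_left s' + (if b then 0 else cell_len s' * p (size s'))
  else 0.

(** Nested subdivision of the unit interval: the list s, read from its last
    element to its first, records the choices made so far, and each cell is
    cut in the proportions p and 1 - p of its level.  Under the uniform law
    the successive choices are independent. *)
Definition cell (s : seq bool) : set R :=
  [set x | cell_left s <= x < cell_left s + cell_len s].

Definition digit_event (n : nat) : set R :=
  \bigcup_(s in [set s | size s = n]) cell (true :: s).

Definition unit_uniform :
  probability (g_sigma_algebraType (R.-ocitv.-measurable)) R :=
  uniform_prob (@ltr01 R).

Lemma cell_len_ge0 s : 0 <= cell_len s.
Proof.
elim: s => //= b s IH; apply: mulr_ge0 => //.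
by have /andP[? ?] := p01 (size s); case: b => //; rewrite subr_ge0.
Qed.

Lemma cell_bounds s : 0 <= cell_left s /\ cell_left s + cell_len s <= 1.
Proof.
elim: s => [|b s [IH1 IH2]] /=; first by rewrite add0r.
have := cell_len_ge0 s; have /andP[p0 p1] := p01 (size s) => l0.
have l1 : 0 <= cell_len s * p (size s) by exact: mulr_ge0.
have l2 : 0 <= cell_len s * (1 - p (size s)).
  by apply: mulr_ge0 => //; rewrite subr_ge0.
by case: b; split; lra.
Qed.

Lemma cell_split s :
  cell s = cell (true :: s) `|` cell (false :: s).
Proof.
have := cell_len_ge0 s; have /andP[p0 p1] := p01 (size s) => l0.
have l1 : 0 <= cell_len s * p (size s) by exact: mulr_ge0.
have l2 : 0 <= cell_len s * (1 - p (size s)).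
  by apply: mulr_ge0 => //; rewrite subr_ge0.
apply/seteqP; split=> x; rewrite /cell /=.
  move=> /andP[x1 x2].
  have [xl|xl] := ltP x (cell_left s + cell_len s * p (size s)).
    by left; apply/andP; split; lra.
  by right; apply/andP; split; lra.
by move=> [] /andP[? ?]; apply/andP; split; lra.
Qed.

Lemma cell_children_disjoint s : cell (true :: s) `&` cell (false :: s) = set0.
Proof.
apply/seteqP; split=> x //; rewrite /cell /=.
by move=> [/andP[? ?] /andP[? ?]]; lra.
Qed.

Lemma cell_sub b s : cell (b :: s) `<=` cell s.
Proof. by rewrite (cell_split s); case: b; [left|right]. Qed.

Lemma cell_inj s t x : size s = size t -> cell s x -> cell t x -> s = t.
Proof.
elim: s t => [|b s IH] [|c t] //= [st] sx tx.
have E := IH t st (cell_sub sx) (cell_sub tx); subst t; congr (_ :: _).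
have F : ~ (cell (true :: s) x /\ cell (false :: s) x).
  by move=> h; have : set0 x by rewrite -(cell_children_disjoint s).
by case: b c sx tx => -[] // ? ?; case: F.
Qed.

Lemma cell_itv s : cell s = `[cell_left s, cell_left s + cell_len s[%classic.
Proof. by apply/seteqP; split=> x; rewrite /= in_itv. Qed.

Lemma measurable_cell s : measurable (cell s).
Proof. by rewrite cell_itv; exact: measurable_itv. Qed.

Lemma prob_cell s : unit_uniform (cell s) = (cell_len s)%:E.
Proof.
have [l0 l1] := cell_bounds s; have len0 := cell_len_ge0 s.
rewrite /unit_uniform /= /uniform_prob integral_uniform_pdf setIidl; last first.
  move=> x; rewrite /cell /= in_itv /= => /andP[? ?].
  by apply/andP; split; lra.
rewrite (eq_integral (fun=> 1%:E)); last first.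
  move=> x; rewrite inE /cell /= /uniform_pdf => /andP[? ?].
  by rewrite subr0 invr1 ifT //; apply/andP; split; lra.
rewrite integral_cst; last exact: measurable_cell.
rewrite mul1e cell_itv /= lebesgue_measure_itv /= lte_fin ltrDl.
case: ifPn => [_|]; first by rewrite -EFinB addrC addKr.
by rewrite -leNgt => h; congr EFin; apply/le_anti/andP; split.
Qed.

Lemma measurable_digit_event n : measurable (digit_event n).
Proof.
rewrite /digit_event bigcup_mkcond.
apply: countable_bigcupT_measurable; first exact: countableP.
by move=> s; case: ifP => _ //; exact: measurable_cell.
Qed.

Lemma cell_true_digit s : cell (true :: s) `<=` digit_event (size s).
Proof. by move=> x xs; exists s. Qed.

Lemma cell_false_digit s : cell (false :: s) `&` digit_event (size s) = set0.
Proof.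
apply/seteqP; split=> x // [xs [t /= st xt]].
by have := cell_inj (s := false :: s) (t := true :: t) (congr1 S (esym st)) xs xt.
Qed.

Definition digits_event (J : pred nat) (m M : nat) : set R :=
  [set x | forall n, (m <= n < M)%N -> J n -> digit_event n x].

Lemma measurable_digits_event J m M : measurable (digits_event J m M).
Proof.
rewrite (_ : digits_event J m M =
  \bigcap_(n in [set n | (m <= n < M)%N /\ J n]) digit_event n).
  apply: bigcap_measurableType => n _; exact: measurable_digit_event.
by apply/seteqP; split => x xn n; [move=> [? ?]; exact: xn|move=> ? ?; exact: xn].
Qed.

(** The cell is cut into its two children; if the level is in J, the
    right child does not contribute and the left one meets the constraint. *)
Lemma prob_digits_event J M k s : (size s + k)%N = M ->
  unit_uniform (cell s `&` digits_event J (size s) M) =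
  (cell_len s * \prod_(size s <= n < M) (if J n then p n else 1))%:E.
Proof.
elim: k s => [|k IH] s sM.
  rewrite big_geq -?sM ?addn0 // mulr1 -prob_cell setIidl //.
  by move=> x _ n /andP[h1 h2]; have := leq_ltn_trans h1 h2; rewrite ltnn.
have sM' : (size s < M)%N by rewrite -sM addnS ltnS leq_addr.
have -> : unit_uniform (cell s `&` digits_event J (size s) M) =
    (unit_uniform (cell (true :: s) `&` digits_event J (size s) M) +
     unit_uniform (cell (false :: s) `&` digits_event J (size s) M))%E.
  rewrite (cell_split s) setIUl measureU //.
  - by apply: measurableI; [exact: measurable_cell|exact: measurable_digits_event].
  - by apply: measurableI; [exact: measurable_cell|exact: measurable_digits_event].
  - by rewrite setIACA cell_children_disjoint set0I.
have step b : (~~ J (size s)) || b ->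
   cell (b :: s) `&` digits_event J (size s) M =
   cell (b :: s) `&` digits_event J (size (b :: s)) M.
  move=> Jb; apply/seteqP; split=> x [xs xD]; split=> //.
    by move=> n /andP[n1 n2]; apply: xD; rewrite (ltnW n1).
  move=> n /andP[n1 n2] Jn; have [ns|ns] := eqVneq n (size s).
    move: Jb; rewrite -ns Jn /= => bT; rewrite ns.
    by apply: cell_true_digit; rewrite bT in xs.
  by apply: xD => //=; rewrite n2 ltn_neqAle eq_sym ns n1.
have IH' b : unit_uniform (cell (b :: s) `&` digits_event J (size (b :: s)) M) =
   (cell_len (b :: s) *
     \prod_((size s).+1 <= n < M) (if J n then p n else 1))%:E.
  by apply: IH; rewrite /= addSn -addnS.
rewrite (big_ltn sM').
rewrite step ?orbT // IH'.
have [Js|Js] := boolP (J (size s)); last first.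
  by rewrite step ?Js // IH' -EFinD /=; congr EFin; ring.
have -> : cell (false :: s) `&` digits_event J (size s) M = set0.
  apply/seteqP; split=> x // [xs xD]; rewrite -(cell_false_digit s); split => //.
  by apply: xD => //; rewrite leqnn.
by rewrite measure0 adde0 /=; congr EFin; ring.
Qed.

Lemma prob_in_cell_nil A : measurable A ->
  unit_uniform A = unit_uniform (cell [::] `&` A).
Proof.
have cell01 : unit_uniform (~` cell [::]) = 0%E.
  rewrite probability_setC ?prob_cell /= ?subee //; exact: measurable_cell.
move=> mA; have mc := measurable_cell [::].
  rewrite -[in LHS](setIT A) -(setUv (cell [::])) setIUr measureU; last 3 first.
  - exact: measurableI.
  - by apply: measurableI => //; exact: measurableC.
  - by rewrite setIACA setICr setI0.
  rewrite [X in (_ + X)%E](_ : _ = 0%E) ?adde0 1?setIC //.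
  apply/eqP; rewrite eq_le measure_ge0 andbT -cell01 le_measure ?inE //.
    by apply: measurableI => //; exact: measurableC.
  exact: measurableC.
Qed.

Lemma prob_digit_event n : unit_uniform (digit_event n) = (p n)%:E.
Proof.
  pose K := pred1 n.
  have -> : digit_event n = digits_event K 0 n.+1.
    apply/seteqP; split=> x; first by move=> xn m _ /eqP ->.
    by apply => //=.
  rewrite prob_in_cell_nil; last exact: measurable_digits_event.
  rewrite (@prob_digits_event K n.+1 n.+1 [::]) //= mul1r; congr EFin.
  rewrite big_nat_recr //= eqxx big1_seq ?mul1r // => i.
  by rewrite mem_index_iota => /andP[_ /ltn_eqF ->].
Qed.

Lemma digit_events_independent :
  mutually_independent unit_uniform digit_event.
Proof.
move=> J; pose M := (\max_(n <- J) n).+1.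
have JM n : n \in J -> (n < M)%N.
  by move=> nJ; rewrite ltnS; exact: leq_bigmax_seq.
have -> : \bigcap_(n in [set` J]) digit_event n = digits_event (mem J) 0 M.
  by apply/seteqP; split=> x xJ n; [move=> _; exact: xJ|move=> nJ; apply: xJ => //=; exact: JM].
rewrite prob_in_cell_nil; last exact: measurable_digits_event.
rewrite (@prob_digits_event (mem J) M M [::]) //= mul1r.
under [RHS]eq_bigr do rewrite prob_digit_event.
rewrite prodEFin; congr EFin.
rewrite -big_mkcond /= -big_filter; apply: perm_big; apply: uniq_perm.
- exact/filter_uniq/iota_uniq.
- exact: fset_uniq.
- move=> n; rewrite mem_filter mem_index_iota /= andb_idr // => /JM //.
Qed.

End nested_intervals.

Lemma indep_family_exists (R : realType) (I : countType) (a : I -> R) :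
  (forall i, 0 <= a i <= 1) ->
  exists (disp : measure_display) (T : measurableType disp)
    (P : probability T R) (Z : T -> set I),
    [/\ random_set Z, forall i, P [set w | Z w i] = (a i)%:E &
        mutually_independent P (fun i => [set w | Z w i])].
Proof.
move=> a01.
pose p n := if @choice.unpickle I n is Some i then a i else 0.
have p01 n : 0 <= p n <= 1 by rewrite /p; case: (@choice.unpickle I n) => // ; rewrite lexx ler01.
exists _, _, (unit_uniform R), (fun x => [set i | digit_event p (choice.pickle i) x]).
split.
- move=> i; exact: measurable_digit_event.
- by move=> i; rewrite prob_digit_event // /p choice.pickleK.
- apply: (mutually_independent_inj (g := choice.pickle) _ (digit_events_independent p01)).
  exact: (pcan_inj choice.pickleK).
Qed.

(** * Product spaces and probability bounds *)

Section products.
Variables (R : realType) (disp1 disp2 : measure_display)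
  (T1 : measurableType disp1) (T2 : measurableType disp2)
  (P1 : probability T1 R) (P2 : probability T2 R).

Definition product_prob : probability (T1 * T2)%type R := (P1 \x P2)%E.

Lemma product_probE A1 A2 : measurable A1 -> measurable A2 ->
  product_prob (A1 `*` A2) = (P1 A1 * P2 A2)%E.
Proof. by move=> m1 m2; exact: product_measure1E. Qed.

Lemma mutually_independent_prod (K : choiceType) (E1 : K -> set T1)
    (E2 : K -> set T2) :
  (forall k, measurable (E1 k)) -> (forall k, measurable (E2 k)) ->
  mutually_independent P1 E1 -> mutually_independent P2 E2 ->
  mutually_independent product_prob (fun k => E1 k `*` E2 k).
Proof.
move=> m1 m2 i1 i2 J.
have -> : \bigcap_(k in [set` J]) (E1 k `*` E2 k) =
    (\bigcap_(k in [set` J]) E1 k) `*` (\bigcap_(k in [set` J]) E2 k).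
  apply/seteqP; split=> -[x y].
    by move=> h; split=> k kJ; have [] := h k kJ.
  by move=> [h1 h2] k kJ; split; [exact: h1|exact: h2].
rewrite product_probE; last 2 first.
- by apply: fin_bigcap_measurable => [|l _]; [exact: finite_fset|exact: m1].
- by apply: fin_bigcap_measurable => [|l _]; [exact: finite_fset|exact: m2].
rewrite i1 i2 -big_split /=; apply: eq_bigr => k _.
by rewrite product_probE.
Qed.

(** Two independent families placed on the two factors of a
    product space form one independent family. *)
Lemma mutually_independent_sum (I K : choiceType) (E1 : I -> set T1)
    (E2 : K -> set T2) :
  (forall k, measurable (E1 k)) -> (forall k, measurable (E2 k)) ->
  mutually_independent P1 E1 -> mutually_independent P2 E2 ->
  mutually_independent product_prob (fun x : (I + K)%type =>
    match x with inl i => fst @^-1` E1 i | inr k => snd @^-1` E2 k end).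
Proof.
move=> m1 m2 i1 i2 J.
pose l (x : I + K) : option I := if x is inl i then Some i else None : option I.
pose r (x : I + K) : option K := if x is inr i then Some i else None : option K.
pose J1 := [fset i in pmap l (J : seq (I + K))]%fset.
pose J2 := [fset i in pmap r (J : seq (I + K))]%fset.
have inJ1 i : (i \in J1) = (inl i \in J).
  rewrite !inE /= mem_pmap; apply/mapP/idP => [[[j|j] jJ //= [->]] //|iJ].
  by exists (inl i).
have inJ2 i : (i \in J2) = (inr i \in J).
  rewrite !inE /= mem_pmap; apply/mapP/idP => [[[j|j] jJ //= [->]] //|iJ].
  by exists (inr i).
have -> : \bigcap_(x in [set` J]) (match x with
      inl i => fst @^-1` E1 i | inr k => snd @^-1` E2 k end) =
    (\bigcap_(k in [set` J1]) E1 k) `*` (\bigcap_(k in [set` J2]) E2 k).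
  apply/seteqP; split=> -[x y].
    move=> h; split=> k /=; rewrite ?inJ1 ?inJ2 => kJ.
      by have := h (inl k) kJ.
    by have := h (inr k) kJ.
  move=> [h1 h2] [i|k] kJ /=; first by apply: h1; rewrite /= inJ1.
  by apply: h2; rewrite /= inJ2.
rewrite product_probE; last 2 first.
- by apply: fin_bigcap_measurable => [|k _]; [exact: finite_fset|exact: m1].
- by apply: fin_bigcap_measurable => [|k _]; [exact: finite_fset|exact: m2].
rewrite i1 i2.
have pJ : perm_eq J (map inl J1 ++ map inr J2).
  apply: uniq_perm; first exact: fset_uniq.
    rewrite cat_uniq !map_inj_uniq ?fset_uniq ?andbT /=; last 2 first.
    - by move=> ? ? [].
    - by move=> ? ? [].
    by apply/hasPn => _ /mapP[k _ ->]; apply/negP => /mapP[].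
  move=> [i|k]; rewrite mem_cat.
    rewrite mem_map; last by move=> ? ? [].
    rewrite inJ1; case: (_ \in J) => //=; apply/esym/negbTE.
    by apply/negP => /mapP[].
  rewrite orbC mem_map; last by move=> ? ? [].
  rewrite inJ2; case: (_ \in J) => //=; apply/esym/negbTE.
  by apply/negP => /mapP[].
rewrite (perm_big _ pJ) big_cat !big_map /=; congr (_ * _)%E.
  apply: eq_bigr => i _; rewrite -setXT -[in LHS](mule1 (P1 _)).
  by rewrite product_probE // probability_setT.
apply: eq_bigr => i _; rewrite -setTX -[in LHS](mul1e (P2 _)).
by rewrite product_probE // probability_setT.
Qed.

Lemma measurable_fst_preimage (A : set T1) : measurable A ->
  measurable (fst @^-1` A : set (T1 * T2)).
Proof. by move=> mA; rewrite -setXT; exact: measurableX. Qed.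

Lemma measurable_snd_preimage (A : set T2) : measurable A ->
  measurable (snd @^-1` A : set (T1 * T2)).
Proof. by move=> mA; rewrite -setTX; exact: measurableX. Qed.

Lemma product_prob_fst A : measurable A -> product_prob (fst @^-1` A) = P1 A.
Proof. by move=> mA; rewrite -setXT product_probE // probability_setT mule1. Qed.

Lemma product_prob_snd A : measurable A -> product_prob (snd @^-1` A) = P2 A.
Proof. by move=> mA; rewrite -setTX product_probE // probability_setT mul1e. Qed.

(** Fubini: the complement of A is negligible, so almost all of its
    sections are. *)
Lemma product_prob_ae_section (A : set (T1 * T2)) : measurable A -> product_prob A = 1%E ->
  {ae P1, forall x, P2 (xsection A x) = 1%E}.
Proof.
move=> mA PA.
have mN : measurable (~` A) by exact: measurableC.
have : (\int[P1]_x `|(P2 \o xsection (~` A)) x|)%E = 0%E.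
  transitivity (product_prob (~` A)); last by rewrite probability_setC // PA subee.
  by apply: eq_integral => x _; rewrite gee0_abs.
move/(ae_eq_integral_abs P1 measurableT (measurable_fun_xsection P2 mN)).
apply: filterS => x /(_ I) /=.
have -> : xsection (~` A) x = ~` xsection A x.
  apply/seteqP; split=> y; rewrite /xsection /=.
    by move=> /set_mem h; apply/negP; rewrite notin_setE.
  by move=> /negP; rewrite notin_setE => h; apply/mem_set.
have mX : measurable (xsection A x) by exact: measurable_xsection.
rewrite probability_setC // => h.
have fX : P2 (xsection A x) \is a fin_num by exact: fin_num_measure.
move: h; rewrite -(fineK fX) -EFinB => -[] /eqP.
by rewrite subr_eq0 => /eqP <-.
Qed.

End products.

Section bounds.
Variables (R : realType) (disp : measure_display) (T : measurableType disp)
  (P : probability T R).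

(** Conditioning on a countably valued variable C: if, on each event
    C = k, the conditional probability of Q k is at most c, the same bound
    holds for the event Q (C w) whose choice depends on C. *)
Lemma conditional_bound (K : countType) (C : T -> K) (Q : K -> set T) (c : R) :
  0 <= c ->
  (forall k, measurable [set w | C w = k]) -> (forall k, measurable (Q k)) ->
  (forall k, P ([set w | C w = k] `&` Q k) <= c%:E * P [set w | C w = k])%E ->
  measurable [set w | Q (C w) w] /\ (P [set w | Q (C w) w] <= c%:E)%E.
Proof.
move=> c0 mC mQ PQ.
pose G n := [set w | choice.pickle (C w) = n].
pose F n := [set w | choice.pickle (C w) = n /\ Q (C w) w].
have FG n : measurable (G n) /\ measurable (F n) /\ (P (F n) <= c%:E * P (G n))%E.
  have [[k kn]|nk] := pselect (exists k : K, choice.pickle k = n).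
    have -> : G n = [set w | C w = k].
      by apply/seteqP; split=> w /=; [rewrite /G /= -kn => /(pcan_inj choice.pickleK)|
        rewrite /G /= => ->].
    have -> : F n = [set w | C w = k] `&` Q k.
      apply/seteqP; split=> w /=; rewrite /F /= -kn.
        by move=> [/(pcan_inj choice.pickleK) <-].
      by move=> [->].
    by split=> //; split; [exact: measurableI|].
  have -> : G n = set0 by apply/seteqP; split=> w //= h; apply: nk; exists (C w).
  have -> : F n = set0 by apply/seteqP; split=> w //= [h _]; apply: nk; exists (C w).
  by rewrite measure0 mule0.
have UF : [set w | Q (C w) w] = \bigcup_n F n.
  apply/seteqP; split=> w /=; first by move=> Qw; exists (choice.pickle (C w)).
  by move=> [n _ []].
have UG : setT = \bigcup_n G n.
  by apply/seteqP; split=> w //= _; exists (choice.pickle (C w)).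
have mF n : setT n -> measurable (F n) by move=> _; have [_ []] := FG n.
have mG n : setT n -> measurable (G n) by move=> _; have [] := FG n.
have tF : trivIset setT F by move=> i j _ _ [w [[<- _] [<- _]]].
have tG : trivIset setT G by move=> i j _ _ [w [<- <-]].
rewrite UF; split; first by apply: bigcup_measurable => n _; exact: mF.
rewrite (measure_bigcup P setT _ mF tF).
have -> : c%:E = (c%:E * P setT)%E by rewrite probability_setT mule1.
rewrite UG (measure_bigcup P setT _ mG tG) -nneseriesZl //.
by apply: lee_nneseries => // n _; have [_ []] := FG n.
Qed.

Lemma union_bound (K : eqType) (s : seq K) (F : K -> set T) :
  (forall k, measurable (F k)) ->
  measurable [set w | exists2 k, k \in s & F k w] /\
  (P [set w | exists2 k, k \in s & F k w] <= \sum_(k <- s) P (F k))%E.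
Proof.
move=> mF; elim: s => [|k s [mU PU]].
  have -> : [set w | exists2 k, k \in [::] & F k w] = set0.
    by apply/seteqP; split=> w // [].
  by rewrite measure0 big_nil.
have -> : [set w | exists2 l, l \in k :: s & F l w] =
    F k `|` [set w | exists2 l, l \in s & F l w].
  apply/seteqP; split=> w.
    move=> [l]; rewrite inE => /orP[/eqP -> ?|ls ?]; first by left.
    by right; exists l.
  move=> [?|[l ls ?]]; first by exists k => //; rewrite mem_head.
  by exists l => //; rewrite inE ls orbT.
split; first exact: measurableU.
rewrite big_cons; apply: (le_trans (measureU2 _ _ _)) => //.
exact: leeD2l.
Qed.

Lemma mutually_independentC (I : choiceType) (E : I -> set T) (J : {fset I}) :
  (forall i, measurable (E i)) -> mutually_independent P E ->
  P (\bigcap_(i in [set` J]) ~` E i) = (\prod_(i <- J) (1 - P (E i)))%E.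
Proof.
move=> mE iE; pose Z w := [set i | E i w].
have mZ : random_set Z by exact: mE.
have eE i : (fun w => Z w `&` [set i]) @^-1` (~` [set S : setspace I | S i]) =
    ~` E i.
  apply/seteqP; split=> w /=; first by move=> h Ei; apply: h.
  by move=> nE [].
have h := @indep_blocks R I disp T P Z mZ iE I (fun i => [set i])
  (fun i => ~` [set S | S i]).
transitivity (P (\bigcap_(i in [set` J])
    ((fun w => Z w `&` [set i]) @^-1` (~` [set S : setspace I | S i])))).
  by congr (P _); apply: eq_bigcapr => i _; rewrite eE.
apply: (etrans (h _ _ J)).
- by move=> k l kl; apply/seteqP; split=> i // [-> /= klE]; rewrite klE eqxx in kl.
- by move=> k; apply: measurableC; exact: measurable_cyl.
apply: eq_bigr => i _.
by rewrite [X in P X]eE probability_setC.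
Qed.
End bounds.

(** * Connectivity in subgraphs of the lattice *)

Section connectivity.
Variable d : nat.
Implicit Types (X : set (edge d)) (S : set (vertex d)) (x y z : vertex d).

Lemma adjacent_sym X x y : adjacent X x y -> adjacent X y x.
Proof. by move=> [e Xe [[-> ->]|[-> ->]]]; exists e => //; [right|left]. Qed.

Lemma connected_in_refl X S x : S x -> connected_in X S x x.
Proof. by move=> Sx; exists [::]; split => // z; rewrite inE => /eqP ->. Qed.

Lemma connected_in_step X S x y z : S x -> adjacent X x y ->
  connected_in X S y z -> connected_in X S x z.
Proof.
move=> Sx xy [s [ps ls hs]]; exists (y :: s); split => //=.
  by rewrite ps andbT; apply/asboolP.
by move=> u; rewrite inE => /orP[/eqP -> //|]; exact: hs.
Qed.

Lemma connected_in_trans X S x y z : connected_in X S x y ->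
  connected_in X S y z -> connected_in X S x z.
Proof.
move=> [s [ps ls hs]] [t [pt lt ht]]; exists (s ++ t); split.
- by rewrite cat_path ps ls.
- by rewrite last_cat ls.
- move=> u; rewrite -cat_cons mem_cat => /orP[|ut]; first exact: hs.
  by apply: ht; rewrite inE ut orbT.
Qed.

Lemma connected_in_ends X S x y : connected_in X S x y -> S x /\ S y.
Proof.
move=> [s [_ <- hs]]; split; apply: hs; first exact: mem_head.
exact: mem_last.
Qed.

Lemma connected_in_edge X S x y : S x -> S y -> adjacent X x y ->
  connected_in X S x y.
Proof.
by move=> Sx Sy xy; apply: (connected_in_step Sx xy); exact: connected_in_refl.
Qed.

(** Induction along a path; it avoids handling paths as lists. *)
Lemma connected_in_ind X S (Q : vertex d -> Prop) x y :
  (forall u v, S u -> S v -> adjacent X u v -> Q u -> Q v) ->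
  connected_in X S x y -> Q x -> Q y.
Proof.
move=> QS [s [ps ls hs]] Qx; subst y.
elim: s x Qx ps hs => //= u s IH x Qx /andP[/asboolP xu ps] hs.
apply: IH => //; last by move=> z zs; apply: hs; rewrite inE zs orbT.
by apply: QS Qx => //; apply: hs; rewrite !inE eqxx ?orbT.
Qed.

Lemma connected_in_sym X S x y : connected_in X S x y -> connected_in X S y x.
Proof.
move=> xy; have [Sx _] := connected_in_ends xy.
apply: (connected_in_ind (Q := fun z => connected_in X S z x) _ xy).
  move=> u v Su Sv uv ux; apply: connected_in_step ux => //.
  exact: adjacent_sym.
exact: connected_in_refl.
Qed.

(** Only the edges with both endpoints in S matter, which is what makes
    connectivity inside S a local event. *)
Lemma connected_in_sub X X' S S' x y : S `<=` S' ->
  (forall e, S (endpoint1 e) -> S (endpoint2 e) -> X e -> X' e) ->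
  connected_in X S x y -> connected_in X' S' x y.
Proof.
move=> SS' XX' xy; have [Sx _] := connected_in_ends xy.
apply: (connected_in_ind (Q := fun z => connected_in X' S' x z) _ xy).
  move=> u v Su Sv [e Xe uv] xu; apply: connected_in_trans xu _.
  apply: connected_in_edge; [exact: SS'|exact: SS'|].
  by exists e => //; apply: XX' => //; case: uv => -[? ?]; subst.
by apply: connected_in_refl; exact: SS'.
Qed.

Lemma connected_inS X X' S x y : X `<=` X' ->
  connected_in X S x y -> connected_in X' S x y.
Proof. by move=> XX'; apply: connected_in_sub => // e _ _; exact: XX'. Qed.

End connectivity.

Section measurability.
Variables (disp : measure_display) (T : measurableType disp).

Lemma measurable_exists (U : countType) (F : U -> T -> Prop) :
  (forall u, measurable [set w | F u w]) -> measurable [set w | exists u, F u w].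
Proof.
move=> mF; rewrite (_ : [set _ | _] = \bigcup_u [set w | F u w]).
  by apply: countable_bigcupT_measurable => //; exact: countableP.
by apply/seteqP; split=> w [u]; [exists u|exists u].
Qed.

Lemma measurable_forall (U : countType) (F : U -> T -> Prop) :
  (forall u, measurable [set w | F u w]) -> measurable [set w | forall u, F u w].
Proof.
move=> mF; rewrite (_ : [set _ | _] = ~` [set w | exists u, ~ F u w]).
  apply: measurableC; apply: measurable_exists => u.
  by rewrite -[X in measurable X]/(~` [set w | F u w]); exact: measurableC.
by apply/seteqP; split=> w /=; [move=> h [u]; exact|
  move=> h u; apply: contrapT => nF; apply: h; exists u].
Qed.

Lemma measurable_cst (Q : Prop) : measurable [set w : T | Q].
Proof.
have [q|nq] := pselect Q.
  by rewrite (_ : [set _ | _] = setT) //; apply/seteqP; split.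
by rewrite (_ : [set _ | _] = set0) //; apply/seteqP; split.
Qed.

Lemma measurable_conj (Q1 Q2 : T -> Prop) : measurable [set w | Q1 w] ->
  measurable [set w | Q2 w] -> measurable [set w | Q1 w /\ Q2 w].
Proof. exact: measurableI. Qed.

Lemma measurable_impl (Q1 Q2 : T -> Prop) : measurable [set w | Q1 w] ->
  measurable [set w | Q2 w] -> measurable [set w | Q1 w -> Q2 w].
Proof.
move=> m1 m2; rewrite (_ : [set _ | _] = ~` [set w | Q1 w] `|` [set w | Q2 w]).
  by apply: measurableU => //; exact: measurableC.
by apply/seteqP; split=> w /=; have [] := pselect (Q1 w); tauto.
Qed.

Lemma measurable_iff (Q1 Q2 : T -> Prop) : measurable [set w | Q1 w] ->
  measurable [set w | Q2 w] -> measurable [set w | Q1 w <-> Q2 w].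
Proof. by move=> m1 m2; apply: measurable_conj; exact: measurable_impl. Qed.

Lemma measurable_neg (Q1 : T -> Prop) : measurable [set w | Q1 w] ->
  measurable [set w | ~ Q1 w].
Proof. exact: measurableC. Qed.

Variables (d : nat) (G : T -> set (edge d)).
Hypothesis mG : random_set G.

Lemma measurable_adjacent x y : measurable [set w | adjacent (G w) x y].
Proof.
rewrite (_ : [set _ | _] = [set w | exists e : edge d, G w e /\
    ((x = endpoint1 e /\ y = endpoint2 e) \/
     (x = endpoint2 e /\ y = endpoint1 e))]).
  apply: measurable_exists => e; apply: measurable_conj; first exact: mG.
  exact: measurable_cst.
by apply/seteqP; split=> w; [move=> [e ? ?]; exists e|move=> [e [? ?]]; exists e].
Qed.

Lemma measurable_connected_in S x y :
  measurable [set w | connected_in (G w) S x y].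
Proof.
apply: (@measurable_exists (seq (vertex d))) => s.
rewrite (_ : [set _ | _] =
  [set w | path (fun u v => `[< adjacent (G w) u v >]) x s /\
     (last x s = y /\ forall z, z \in x :: s -> S z)]); last first.
  by apply/seteqP; split=> w; [move=> [? ? ?]|move=> [? [? ?]]].
apply: measurable_conj; last exact: measurable_cst.
elim: s x => [|u s IH] x /=; first exact: measurable_cst.
rewrite (_ : [set _ | _] = [set w | adjacent (G w) x u /\
    path (fun u v => `[< adjacent (G w) u v >]) u s]).
  by apply: measurable_conj => //; exact: measurable_adjacent.
by apply/seteqP; split=> w /=; [move=> /andP[/asboolP]|move=> [/asboolP -> ->]].
Qed.
End measurability.

Lemma random_set_setUl (I : Type) (disp : measure_display)
    (T : measurableType disp) (Z : T -> set I) (X : set I) :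
  random_set Z -> random_set (fun w => X `|` Z w).
Proof.
move=> mZ i; have mU := measurableU _ _ (@measurable_cst _ T (X i)) (mZ i).
exact: mU.
Qed.

Section sup_distance.
Variable d : nat.
Implicit Types (c x y z : vertex d).

Definition rho c z : nat := \max_(j < d) absz (z 0 j - c 0 j)%R.

Lemma rho_leP c z r : reflect (forall j, (absz (z 0 j - c 0 j)%R <= r)%N) (rho c z <= r)%N.
Proof.
apply: (iffP (bigmax_leqP _ _ _)) => h j; first exact: h.
by move=> _; exact: h.
Qed.

Lemma rho_ge c z j : (absz (z 0 j - c 0 j)%R <= rho c z)%N.
Proof. by apply/rho_leP. Qed.

Lemma boxE c z r : box r (z - c) = (rho c z <= r)%N.
Proof.
apply/propext; split.
  by move=> h; apply/rho_leP => j; have := h j; rewrite !mxE -abszE lez_nat.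
by move=> /rho_leP h j; have := h j; rewrite !mxE -abszE lez_nat.
Qed.

Lemma rho_attained c z : (0 < d)%N -> exists j, absz (z 0 j - c 0 j)%R = rho c z.
Proof.
move=> d0; have [|j jE] := @bigop.eq_bigmax 'I_d (fun j => absz (z 0 j - c 0 j)%R).
  by rewrite card_ord.
by exists j.
Qed.

Lemma endpoint2E (e : edge d) j :
  endpoint2 e 0 j = endpoint1 e 0 j + (j == e.2)%:R.
Proof. by rewrite !mxE eqxx. Qed.

Lemma rho_adjacent (X : set (edge d)) c x y : adjacent X x y ->
  (rho c y <= (rho c x).+1)%N.
Proof.
move=> [e _ xy]; apply/rho_leP => j; have := rho_ge c x j.
by case: xy => -[-> ->]; rewrite endpoint2E; case: (j == _) => /=; lia.
Qed.

(** Stated for duplicate-free lists, so that it bounds both the number of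
    vertices of the ball and the size of the clusters inside it. *)
Lemma ball_size c m (s : seq (vertex d)) : uniq s ->
  (forall z, z \in s -> (rho c z <= m)%N) -> (size s <= (2 * m + 1) ^ d)%N.
Proof.
move=> us sm.
pose f z := [ffun j : 'I_d => inord (absz (z 0 j - c 0 j + m%:Z)%R) : 'I_(2 * m).+1].
have uf : uniq (map f s).
  rewrite map_inj_in_uniq // => x y xs ys /ffunP fxy.
  apply/rowP => j; move: (fxy j); rewrite !ffunE => /(congr1 val) /=.
  move: (sm x xs) (sm y ys) => /rho_leP/(_ j) hx /rho_leP/(_ j) hy.
  rewrite !inordK; lia.
have := max_card (mem (map f s)).
by rewrite (card_uniqP uf) size_map card_ffun !card_ord addn1.
Qed.

Lemma finite_ball c m : finite_set [set z | (rho c z <= m)%N].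
Proof.
apply: contrapT => /(infinite_set_fset ((2 * m + 1) ^ d).+1)[A sA cA].
have := @ball_size c m A (fset_uniq A) (fun z zA => sA z zA).
by rewrite leqNgt cA.
Qed.

End sup_distance.

(** * Merging of clusters across annuli *)

Section spheres.
Variables (d : nat) (c : vertex d) (r : nat).
Hypothesis hd : (2 <= d)%N.
Implicit Types (x z : vertex d).

Variable Q : vertex d -> Prop.
Hypothesis Qsphere : forall e : edge d,
  rho c (endpoint1 e) = r -> rho c (endpoint2 e) = r ->
  (Q (endpoint1 e) <-> Q (endpoint2 e)).

Definition set_coord z (i : 'I_d) (a : int) : vertex d :=
  \row_j (if j == i then a else z 0 j).

Definition set_coords z (l : seq 'I_d) : vertex d :=
  \row_j (if j \in l then c 0 j + r%:Z else z 0 j).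

Lemma rho_set_coord z i k a : rho c z = r -> k != i ->
  absz (z 0 k - c 0 k)%R = r -> (absz (a - c 0 i)%R <= r)%N ->
  rho c (set_coord z i a) = r.
Proof.
move=> zr ki kr ar; apply/eqP; rewrite eqn_leq; apply/andP; split.
  apply/rho_leP => j; rewrite !mxE; case: eqP => [->//|_].
  by rewrite -zr rho_ge.
have := rho_ge c (set_coord z i a) k; rewrite !mxE (negbTE ki) kr.
exact.
Qed.

(** As long as another coordinate k keeps the vertex at distance r, the
    coordinate i can slide along the whole segment without leaving the
    sphere. *)
Lemma sphere_move z i k a : rho c z = r -> k != i ->
  absz (z 0 k - c 0 k)%R = r -> (absz (a - c 0 i)%R <= r)%N ->
  Q z <-> Q (set_coord z i a).
Proof.
move=> zr ki kr ar.
pose g n := set_coord z i (c 0 i - r%:Z + n%:Z).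
have gE n : (n <= 2 * r)%N -> (Q (g 0%N) <-> Q (g n)).
  elim: n => [//|n IH] nr; apply: (iff_trans (IH _)); first by lia.
  have E : endpoint2 (g n, i) = g n.+1.
    apply/rowP => j; rewrite endpoint2E /= !mxE; case: (j == i) => //=; lia.
  rewrite -E; apply: (@Qsphere (g n, i)).
    by apply: (rho_set_coord zr ki kr); lia.
  by rewrite E; apply: (rho_set_coord zr ki kr); lia.
have gz b : (absz (b - c 0 i)%R <= r)%N ->
    set_coord z i b = g (absz (b - c 0 i + r%:Z)%R).
  by move=> br; congr set_coord; lia.
have -> : Q z = Q (set_coord z i (z 0 i)).
  congr Q; apply/rowP => j; rewrite mxE; by case: eqP => [->|].
have zi : (absz (z 0 i - c 0 i)%R <= r)%N by rewrite -zr rho_ge.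
rewrite (gz _ zi) (gz _ ar); apply: iff_trans; first (apply: iff_sym; apply: gE; lia).
by apply: gE; lia.
Qed.

Lemma sphere_set_coords z k l : rho c z = r -> k \notin l ->
  absz (z 0 k - c 0 k)%R = r ->
  rho c (set_coords z l) = r /\ (Q z <-> Q (set_coords z l)).
Proof.
move=> zr kl kr; elim: l kl => [|i l IH] kl.
  suff -> : set_coords z [::] = z by [].
  by apply/rowP => j; rewrite mxE.
move: kl; rewrite inE negb_or => /andP[ki kl]; have [lr Ql] := IH kl.
have -> : set_coords z (i :: l) = set_coord (set_coords z l) i (c 0 i + r%:Z).
  by apply/rowP => j; rewrite !mxE inE; case: eqP => [->|].
have kE : absz (set_coords z l 0 k - c 0 k)%R = r by rewrite !mxE (negbTE kl).
have ar : (absz (c 0 i + r%:Z - c 0 i)%R <= r)%N by lia.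
split; first exact: rho_set_coord lr ki kE ar.
exact: iff_trans Ql (sphere_move lr ki kE ar).
Qed.

(** All coordinates but an extremal one are moved to their maximal value;
    since d >= 2 one of them then holds the vertex on the sphere while the
    extremal coordinate is moved as well. *)
Lemma sphere_corner z : rho c z = r ->
  (Q z <-> Q (\row_j (c 0 j + r%:Z))).
Proof.
move=> zr; have [k kr] := @rho_attained d c z (ltnW hd); rewrite zr in kr.
pose l := [seq j <- enum 'I_d | j != k].
have kl : k \notin l by rewrite mem_filter eqxx.
have [lr Ql] := sphere_set_coords zr kl kr; apply: (iff_trans Ql).
have [i ik] : exists i : 'I_d, i != k.
  have [k0|k0] := eqVneq (val k) 0%N.
    by exists (Ordinal hd); rewrite -val_eqE /= k0.
  by exists (Ordinal (ltnW hd)); rewrite -val_eqE /= eq_sym.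
have iE : absz (set_coords z l 0 i - c 0 i)%R = r.
  by rewrite !mxE mem_filter ik mem_enum /=; lia.
have ar : (absz (c 0 k + r%:Z - c 0 k)%R <= r)%N by lia.
rewrite (sphere_move lr ik iE ar); set z1 := set_coord _ _ _.
suff -> : z1 = \row_j (c 0 j + r%:Z) by [].
apply/rowP => j; rewrite !mxE mem_filter mem_enum andbT.
by case: eqP => [->|].
Qed.

Lemma sphere_connected x z : rho c x = r -> rho c z = r -> (Q x <-> Q z).
Proof.
by move=> xr zr; rewrite (sphere_corner xr) (sphere_corner zr).
Qed.
End spheres.

(** A set that is not separated by an edge of the sphere is constant
    on the sphere, because the sphere is connected. *)
Lemma sphere_crossing_edge (d : nat) (hd : (2 <= d)%N) (c : vertex d) (r : nat)
    (A : set (vertex d)) (x z : vertex d) :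
  rho c x = r -> rho c z = r -> A x -> ~ A z ->
  exists e : edge d, [/\ rho c (endpoint1 e) = r, rho c (endpoint2 e) = r &
    ~ (A (endpoint1 e) <-> A (endpoint2 e))].
Proof.
move=> xr zr Ax nAz; apply: contrapT => h; apply: nAz.
suff: A x <-> A z by case=> + _; apply.
apply: (@sphere_connected d c r hd A) => // e e1 e2.
by apply: contrapT => ne; apply: h; exists e.
Qed.

Section merging.
Variables (d : nat) (X : set (edge d)) (c : vertex d).
Hypothesis perX : everywhere_percolating X.

Definition ball (m : nat) : set (vertex d) := [set z | (rho c z <= m)%N].

(** The cluster of x is infinite, so it leaves the ball; before its first
    exit it visits every radius in between. *)
Lemma exit_ball m x r : (rho c x <= r)%N -> (r <= m)%N ->
  exists2 u, rho c u = r & connected_in X (ball m) x u.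
Proof.
move=> xr rm.
have [z zm xz] : exists2 z, ~ ball m z & connected_in X setT x z.
  apply: contrapT => h; apply: (perX (x := x)).
  apply: sub_finite_set (finite_ball c m) => z xz.
  by apply: contrapT => nz; apply: h; exists z.
have xm : ball m x by exact: leq_trans xr rm.
pose Q v := (exists2 u, rho c u = r & connected_in X (ball m) x u) \/
  ((rho c v < r)%N /\ connected_in X (ball m) x v).
have : Q z.
  apply: (connected_in_ind (Q := Q) _ xz).
    move=> u v _ _ uv [|[ur xu]]; first by left.
    have vr := rho_adjacent c uv.
    have vm : ball m v by rewrite /ball /=; lia.
    have xv : connected_in X (ball m) x v.
      apply: connected_in_trans xu _; apply: connected_in_edge => //.
      by rewrite /ball /=; lia.
    have [vr'|vr'] := ltnP (rho c v) r; first by right.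
    by left; exists v => //; lia.
  have [xr'|xr'] := ltnP (rho c x) r.
    by right; split => //; exact: connected_in_refl.
  left; exists x; first lia.
  exact: connected_in_refl.
case=> [//|[zr _]]; case: zm; rewrite /ball /=; lia.
Qed.

Variables (m w : nat).
(** The rounds go inwards: round i uses the spheres of radius in
    (lev i.+1, lev i]. *)
Definition lev (i : nat) : nat := (m - i * w)%N.

(** The edges available to the rounds before i.  Edges between two
    spheres are not used, so that each sphere provides its own edges. *)
Definition spherical_edges (i : nat) : set (edge d) :=
  [set e | rho c (endpoint1 e) = rho c (endpoint2 e) /\
    (lev i < rho c (endpoint1 e))%N].

Definition stage (i : nat) (O : set (edge d)) (x y : vertex d) : Prop :=
  connected_in (X `|` (O `&` spherical_edges i)) (ball m) x y.

(** Success of round i for the cluster of x: it contains a whole sphere of the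
    annulus, or an open edge of the annulus leads out of it. *)
Definition merged (i : nat) (O : set (edge d)) (x : vertex d) : Prop :=
  (exists r, [/\ (lev i.+1 < r)%N, (r <= lev i)%N &
     forall z, rho c z = r -> stage i O x z]) \/
  (exists e, [/\ O e, rho c (endpoint1 e) = rho c (endpoint2 e),
     (lev i.+1 < rho c (endpoint1 e))%N, (rho c (endpoint1 e) <= lev i)%N &
     ~ (stage i O x (endpoint1 e) <-> stage i O x (endpoint2 e))]).

Lemma lev_le i j : (i <= j)%N -> (lev j <= lev i)%N.
Proof. by move=> ij; rewrite /lev leq_sub2l // leq_mul2r ij orbT. Qed.

Lemma lev_m i : (lev i <= m)%N.
Proof. exact: leq_subr. Qed.

Lemma stageS i j O x y : (i <= j)%N -> stage i O x y -> stage j O x y.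
Proof.
move=> ij; apply: connected_inS => e [Xe|[Oe [e12 ei]]]; first by left.
by right; split => //; split => //; apply: leq_ltn_trans ei; exact: lev_le.
Qed.

(** If the cluster contains a whole sphere, every other cluster that reaches
    the next level crosses that sphere and there is a single cluster left. *)
Lemma merged_step O i x : (rho c x <= lev i.+1)%N -> merged i O x ->
  (forall y z, (rho c y <= lev i.+1)%N -> (rho c z <= lev i.+1)%N ->
     stage i.+1 O y z) \/
  (exists v, [/\ (rho c v <= lev i)%N, ~ stage i O x v & stage i.+1 O x v]).
Proof.
move=> xi [[r [r1 r2 xr]]|[e [Oe e12 e1 e2 ne]]].
  left=> y z yi zi.
  have h y' : (rho c y' <= lev i.+1)%N -> stage i O x y'.
    move=> y'i; have rm : (r <= m)%N by exact: leq_trans r2 (lev_m i).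
    have y'r : (rho c y' <= r)%N by lia.
    have [u ur y'u] := exit_ball y'r rm.
    apply: connected_in_trans (xr u ur) _; apply: connected_in_sym.
    by apply: connected_inS y'u; left.
  apply: (stageS (leqnSn i)); apply: connected_in_trans (h z zi).
  exact: connected_in_sym (h y yi).
right.
have e1m : ball m (endpoint1 e) by rewrite /ball /=; apply: leq_trans (lev_m i).
have e2m : ball m (endpoint2 e) by rewrite /ball /= -e12.
(* Exactly one endpoint of e is in the cluster of x; the other one is v. *)
have e12' : stage i.+1 O (endpoint1 e) (endpoint2 e).
  apply: connected_in_edge => //; exists e; last by left.
  by right; split.
have [x1|nx1] := pselect (stage i O x (endpoint1 e)).
  exists (endpoint2 e); split; first by rewrite -e12.
    by move=> x2; apply: ne; split.
  exact: connected_in_trans (stageS (leqnSn i) x1) e12'.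
have [x2|nx2] := pselect (stage i O x (endpoint2 e)); last first.
  by case: ne; split.
exists (endpoint1 e); split => //.
by apply: connected_in_trans (stageS (leqnSn i) x2) (connected_in_sym e12').
Qed.

(** While several clusters are left, those reaching level i have at least
    2 ^ i vertices: a merged cluster contains two disjoint clusters of the
    previous round.  This lower bound on sizes replaces a count of clusters. *)
Lemma merged_connected O k :
  (forall i x, (i < k)%N -> (rho c x <= lev i.+1)%N -> merged i O x) ->
  ((2 * m + 1) ^ d < 2 ^ k)%N ->
  forall x y, (rho c x <= lev k)%N -> (rho c y <= lev k)%N ->
  connected_in (X `|` O) (ball m) x y.
Proof.
move=> mer big.
have inv i : (i <= k)%N ->
    (forall y z, (rho c y <= lev i)%N -> (rho c z <= lev i)%N -> stage i O y z)
    \/ (forall x, (rho c x <= lev i)%N -> exists s, [/\ uniq s,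
         size s = (2 ^ i)%N & forall y, y \in s -> stage i O x y]).
  elim: i => [|i IH] ik.
    right=> x x0; exists [:: x]; split => // y; rewrite inE => /eqP ->.
    by apply: connected_in_refl; exact: leq_trans x0 (lev_m _).
  have [one|big'] := IH (ltnW ik).
    left=> y z yi zi; apply: (stageS (leqnSn i)); apply: one;
      by [apply: leq_trans yi _; exact: lev_le|apply: leq_trans zi _; exact: lev_le].
  have [one|none] := pselect (forall y z, (rho c y <= lev i.+1)%N ->
    (rho c z <= lev i.+1)%N -> stage i.+1 O y z); first by left.
  right=> x xi.
  have [//|[v [vi nv xv]]] := merged_step xi (mer i x ik xi).
  have xi' : (rho c x <= lev i)%N by apply: leq_trans xi _; exact: lev_le.
  have [s [us ss xs]] := big' x xi'; have [t [ut st vt]] := big' v vi.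
  exists (s ++ t); split.
  - rewrite cat_uniq us ut andbT /=; apply/hasPn => y yt; apply/negP => ys.
    apply: nv; apply: connected_in_trans (xs y ys) _.
    exact: connected_in_sym (vt y yt).
  - by rewrite size_cat ss st expnS mul2n addnn.
  - move=> y; rewrite mem_cat => /orP[/xs|/vt]; first exact: stageS.
    by move/(stageS (leqnSn i)); exact: connected_in_trans xv.
move=> x y xk yk.
have [one|big'] := inv k (leqnn k).
  apply: connected_inS (one x y xk yk) => e [Xe|[Oe _]]; by [left|right].
have [s [us ss xs]] := big' x xk.
have := @ball_size d c m s us (fun z zs => (connected_in_ends (xs z zs)).2).
by rewrite ss leqNgt big.
Qed.
End merging.

Lemma bernoulli_param_le1 (R : realType) (d : nat) (disp : measure_display)
    (T : measurableType disp) (P : probability T R) (omega : T -> set (edge d))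
    (eps : R) : (0 < d)%N -> bernoulli_percolation P eps omega -> 0 <= 1 - eps.
Proof.
move=> d0 [mo po _]; rewrite subr_ge0 -lee_fin -(po (0, Ordinal d0)).
exact: probability_le1.
Qed.

Section merging_probability.
Variables (R : realType) (d : nat) (hd : (2 <= d)%N) (X : set (edge d))
  (c : vertex d).
Hypothesis perX : everywhere_percolating X.
Variables (disp : measure_display) (T : measurableType disp)
  (P : probability T R) (omega : T -> set (edge d)) (eps : R).
Hypothesis bern : bernoulli_percolation P eps omega.
Variables (m w : nat).
Local Notation lev := (lev m w).
Local Notation stage := (stage X c m w).
Local Notation merged := (merged X c m w).
Local Notation sph := (spherical_edges c m w).

Let m_omega : random_set omega. Proof. by case: bern. Qed.
Let p_omega e : P [set v | omega v e] = eps%:E. Proof. by case: bern. Qed.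
Let i_omega : mutually_independent P (fun e => [set v | omega v e]).
Proof. by case: bern. Qed.

Lemma finite_stage i O x : finite_set [set z | stage i O x z].
Proof.
apply: sub_finite_set (finite_ball c m) => z xz.
exact: (connected_in_ends xz).2.
Qed.

Definition stage_cluster i x v : {fset vertex d} :=
  fset_set [set z | stage i (omega v) x z].

Lemma in_stage_cluster i x v z :
  (z \in stage_cluster i x v) <-> stage i (omega v) x z.
Proof.
rewrite in_fset_set; last exact: finite_stage.
by split; [move/set_mem|move=> h; apply/mem_set].
Qed.

(** Failure of round i when the value of the cluster is frozen to A. *)
Definition sealed i (A : {fset vertex d}) : set T :=
  [set v | ~ (exists r, [/\ (lev i.+1 < r)%N, (r <= lev i)%N &
       forall z, rho c z = r -> z \in A]) /\
    forall e, omega v e -> [/\ rho c (endpoint1 e) = rho c (endpoint2 e),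
     (lev i.+1 < rho c (endpoint1 e))%N & (rho c (endpoint1 e) <= lev i)%N] ->
     ((endpoint1 e \in A) <-> (endpoint2 e \in A))].

Lemma not_mergedE i x v : ~ merged i (omega v) x <-> sealed i (stage_cluster i x v) v.
Proof.
split=> [nm|[nr ne]].
  split=> [[r [r1 r2 rA]]|e oe [e12 e1 e2]].
    by apply: nm; left; exists r; split => // z /rA /in_stage_cluster.
  apply: contrapT => ne; apply: nm; right; exists e; split => //.
  by rewrite -!in_stage_cluster.
move=> [[r [r1 r2 rA]]|[e [oe e12 e1 e2]]].
  by apply: nr; exists r; split => // z /rA /in_stage_cluster.
by apply; rewrite -!in_stage_cluster; apply: ne.
Qed.

Lemma measurable_sealed i A : measurable (sealed i A).
Proof.
apply: measurable_conj; first exact: measurable_cst.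
apply: measurable_forall => e; apply: measurable_impl; first exact: m_omega.
exact: measurable_cst.
Qed.

Definition cluster_is x (A : {fset vertex d}) : set (setspace (edge d)) :=
  [set S | forall z, connected_in (X `|` S) (ball c m) x z <-> z \in A].

Lemma measurable_cluster_is x A : measurable (cluster_is x A).
Proof.
apply: measurable_forall => z; apply: measurable_iff; last exact: measurable_cst.
apply: measurable_connected_in; apply: random_set_setUl.
exact: random_set_id.
Qed.

Lemma stage_clusterE i x A : [set v | stage_cluster i x v = A] =
  (fun v => omega v `&` sph i) @^-1` (cluster_is x A).
Proof.
apply/seteqP; split=> v.
  by move=> /= <- z; exact: iff_sym (in_stage_cluster i x v z).
move=> vA /=; apply/fsetP => z; apply/idP/idP.
  by move=> /in_stage_cluster /vA.
by move=> /vA /in_stage_cluster.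
Qed.

(** The cluster of x at round i is determined by the edges outside the
    annulus.  Given its value A, there is in each of the w spheres an edge on
    the boundary of A; failure forces these w edges to be closed, and they
    are independent of the value of the cluster. *)
Lemma merged_prob i x : (i.+1 * w <= m)%N -> (rho c x <= lev i.+1)%N ->
  measurable [set v | ~ merged i (omega v) x] /\
  (P [set v | ~ merged i (omega v) x] <= ((1 - eps) ^+ w)%:E)%E.
Proof.
move=> iw xi.
have eps1 := bernoulli_param_le1 (ltnW hd) bern.
have -> : [set v | ~ merged i (omega v) x] =
    [set v | sealed i (stage_cluster i x v) v].
  by apply/seteqP; split=> v /=; rewrite not_mergedE.
apply: conditional_bound => //.
- exact: exprn_ge0.
- move=> A; rewrite stage_clusterE.
  exact: random_set_preimage (random_set_setI _ m_omega) (measurable_cluster_is x A).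
- by move=> A; exact: measurable_sealed.
move=> A.
have [[v0 [v0A [v0r _]]]|] := pselect (([set v | stage_cluster i x v = A] `&`
   sealed i A) !=set0); last first.
  move=> e0; have -> : [set v | stage_cluster i x v = A] `&` sealed i A = set0.
    by apply/eqP; apply: contrapT => /negP/set0P.
  by rewrite measure0 mule_ge0 // lee_fin exprn_ge0.
(* A default edge is used outside the annulus, to have a total function f. *)
have ex_edge r : exists e : edge d, (lev i.+1 < r <= lev i)%N ->
    [/\ rho c (endpoint1 e) = r, rho c (endpoint2 e) = r &
    ~ (endpoint1 e \in A <-> endpoint2 e \in A)].
  have [r12|nr] := boolP (lev i.+1 < r <= lev i)%N; last first.
    by exists (0, Ordinal (ltnW hd)).
  have /andP[r1 r2] := r12.
  have [|u ur xu] := @exit_ball d X c perX m x r _ (leq_trans r2 (lev_m _ _ _)).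
    by apply: leq_trans xi _; exact: ltnW.
  have uA : u \in A.
    move: v0A => /= <-; apply/in_stage_cluster; apply: connected_inS xu.
    by left.
  have [z zr zA] : exists2 z, rho c z = r & ~ z \in A.
    apply: contrapT => h; apply: v0r; exists r; split => // z zr.
    by apply: contrapT => zA; apply: h; exists z.
  have [e [? ? ?]] := @sphere_crossing_edge d hd c r [set` A] u z ur zr uA zA.
  by exists e.
have [f fP] := choice ex_edge.
pose J := [fset f r | r in iota (lev i.+1).+1 w]%fset.
have Jr r : r \in iota (lev i.+1).+1 w -> (lev i.+1 < r <= lev i)%N.
  by rewrite mem_iota /lev; lia.
have cJ : #|` J| = w.
  rewrite card_in_imfset /=; last first.
    move=> r s /Jr /fP[r1 _ _] /Jr /fP[s1 _ _] rs.
    by rewrite -r1 -s1 rs.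
  rewrite -[RHS](size_iota (lev i.+1).+1 w) undup_id //.
  exact: iota_uniq.
have JP e : e \in J -> [/\ rho c (endpoint1 e) = rho c (endpoint2 e),
     (lev i.+1 < rho c (endpoint1 e))%N, (rho c (endpoint1 e) <= lev i)%N &
     ~ ((endpoint1 e \in A) <-> (endpoint2 e \in A))].
  move=> /imfsetP[r /= rJ ->]; have /andP[r1 r2] := Jr r rJ.
  by have [-> -> ?] := fP r (Jr r rJ).
pose B : set (setspace (edge d)) :=
  \bigcap_(e in [set` J]) ~` [set S : setspace (edge d) | S e].
have mB : measurable B.
  apply: fin_bigcap_measurable => [|e _]; first exact: finite_fset.
  by apply: measurableC; exact: measurable_cyl.
have BE : (fun v => omega v `&` ~` sph i) @^-1` B =
   \bigcap_(e in [set` J]) ~` [set v | omega v e].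
  apply/seteqP; split=> v vB e eJ /=.
    move=> oe; apply: (vB e eJ); split => //.
    by have [_ _ e2 _] := JP e eJ; move=> [_]; rewrite ltnNge e2.
  by move=> [oe _]; exact: (vB e eJ).
have mC : measurable ([set v | stage_cluster i x v = A]).
  rewrite stage_clusterE.
  exact: random_set_preimage (random_set_setI _ m_omega) (measurable_cluster_is x A).
have mB' : measurable ((fun v => omega v `&` ~` sph i) @^-1` B).
  exact: random_set_preimage (random_set_setI _ m_omega) mB.
apply: (@le_trans _ _ (P ([set v | stage_cluster i x v = A] `&`
    ((fun v => omega v `&` ~` sph i) @^-1` B)))).
  apply: le_measure.
  - by rewrite inE; apply: measurableI => //; exact: measurable_sealed.
  - by rewrite inE; exact: measurableI.
  move=> v [vA [_ vs]]; split => //; rewrite BE => e eJ oe.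
  by have [e12 e1 e2 ne] := JP e eJ; apply: ne; apply: vs.
have indep := @indep_two_blocks R (edge d) disp T P omega m_omega i_omega
   (sph i) (~` sph i) _ B (setICr _) (measurable_cluster_is x A) mB.
rewrite stage_clusterE indep BE mutually_independentC //.
rewrite muleC lee_wpmul2r //.
under eq_bigr do rewrite p_omega -EFinB.
by rewrite prodEFin big_const_seq count_predT cJ iter_mulr_1 lexx.
Qed.

End merging_probability.

Section ball_connectivity.
Variables (R : realType) (d : nat) (hd : (2 <= d)%N).

Lemma ball_connected_prob (X : set (edge d)) (c : vertex d)
    (disp : measure_display) (T : measurableType disp) (P : probability T R)
    (omega : T -> set (edge d)) (eps : R) (k : nat) (n := (k * k)%N) :
  everywhere_percolating X -> bernoulli_percolation P eps omega ->
  ((2 * (2 * n) + 1) ^ d < 2 ^ k)%N ->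
  let E := [set v | forall x y, ball c n x -> ball c n y ->
    connected_in (X `|` omega v) (ball c (2 * n)) x y] in
  measurable E /\
  ((1 - (k * (2 * (2 * n) + 1) ^ d)%:R * (1 - eps) ^+ k)%:E <= P E)%E.
Proof.
move=> perX bern big E.
have mom : random_set omega by case: bern.
have eps1 := bernoulli_param_le1 (ltnW hd) bern.
have mE : measurable E.
  apply: measurable_forall => x; apply: measurable_forall => y.
  apply: measurable_impl; first exact: measurable_cst.
  apply: measurable_impl; first exact: measurable_cst.
  by apply: measurable_connected_in; exact: random_set_setUl.
split => //.
pose m := (2 * n)%N; pose A := fset_set (ball c m).
have inA z : (z \in A) = (rho c z <= m)%N.
  rewrite in_fset_set; last exact: finite_ball.
  by apply/idP/idP => [/set_mem|h]; [|apply/mem_set].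
have sA : (size A <= (2 * m + 1) ^ d)%N.
  by apply: (@ball_size d c m) => [|z]; [exact: fset_uniq|rewrite inA].
pose s := [seq (i, x) | i <- iota 0 k, x <- A].
pose F (q : nat * vertex d) : set T :=
  [set v | (q.1 < k)%N /\ (rho c q.2 <= lev m k q.1.+1)%N /\
    ~ merged X c m k q.1 (omega v) q.2].
have FP q : measurable (F q) /\ (P (F q) <= ((1 - eps) ^+ k)%:E)%E.
  have [|nq] := pselect ((q.1 < k)%N /\ (rho c q.2 <= lev m k q.1.+1)%N).
    move=> [q1 q2].
    have -> : F q = [set v | ~ merged X c m k q.1 (omega v) q.2].
      by apply/seteqP; split=> v // [_ []].
    apply: (merged_prob (w := k) hd perX bern) => //.
    by rewrite /m /n; nia.
  have -> : F q = set0 by apply/seteqP; split=> v // [? [? _]]; apply: nq.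
  by rewrite measure0 lee_fin exprn_ge0.
have [mU PU] := @union_bound R disp T P _ s F (fun q => (FP q).1).
have sub : ~` E `<=` [set v | exists2 q, q \in s & F q v].
  move=> v nE; apply: contrapT => h; apply: nE => x y xn yn.
  apply: (@merged_connected d X c perX m k (omega v) k) => //.
  - move=> i z ik zi; apply: contrapT => nm; apply: h; exists (i, z) => //.
    apply: allpairs_f; first by rewrite mem_iota.
    by rewrite inA; apply: leq_trans zi (lev_m _ _ _).
  - by apply: leq_trans xn _; rewrite /lev /m /n; lia.
  - by apply: leq_trans yn _; rewrite /lev /m /n; lia.
have : (P (~` E) <= ((k * (2 * m + 1) ^ d)%:R * (1 - eps) ^+ k)%:E)%E.
  apply: le_trans (le_measure _ _ _ sub) _; rewrite ?inE //; first exact: measurableC.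
  apply: le_trans PU _.
  apply: (@le_trans _ _ (\sum_(q <- s) ((1 - eps) ^+ k)%:E)%E).
    by apply: lee_sum => q _; exact: (FP q).2.
  rewrite sumEFin lee_fin big_const_seq count_predT iter_addr_0 -[leLHS]mulr_natl.
  apply: ler_wpM2r.
    exact: exprn_ge0.
  by rewrite ler_nat size_allpairs size_iota leq_mul2l sA orbT.
rewrite probability_setC // EFinB leeBlDr ?fin_num_measure //.
by rewrite leeBlDl // addeC.
Qed.

End ball_connectivity.

(** * Local uniqueness at a large scale *)

Section asymptotics.
Variable R : realType.

Lemma natmul_geometric_le (y : R) (k : nat) : 0 <= y < 1 ->
  k%:R * y ^+ k <= (1 - y)^-1.
Proof.
move=> /andP[y0 y1].
have y1' : 0 < 1 - y by rewrite subr_gt0.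
apply: (@le_trans _ _ (\sum_(i < k) y ^+ i)).
  have -> : k%:R * y ^+ k = \sum_(i < k) y ^+ k.
    by rewrite sumr_const card_ord mulr_natl.
  apply: ler_sum => i _; apply: ler_wiXn2l => //; first exact: ltW.
  exact: ltnW.
rewrite -[leRHS]mul1r ler_pdivlMr // mulrC.
have := subrX1 y k; have := exprn_ge0 k y0; set s := \sum_(i < k) _; lra.
Qed.

(** Each factor k is absorbed by a geometric factor of ratio the square root
    of x. *)
Lemma poly_geometric_bounded (j : nat) (x : R) : 0 <= x < 1 ->
  exists M : R, forall k : nat, k%:R ^+ j * x ^+ k <= M.
Proof.
elim: j x => [|j IH] x /andP[x0 x1].
  exists 1 => k; rewrite expr0 mul1r; apply: exprn_ile1 => //; exact: ltW.
pose y := Num.sqrt x.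
have y0 : 0 <= y by exact: sqrtr_ge0.
have yy : y * y = x by rewrite -expr2 sqr_sqrtr.
have y1 : y < 1 by rewrite ltNge; apply/negP => y1; nra.
have y01 : 0 <= y < 1 by rewrite y0.
have [M hM] := IH y y01; exists (M * (1 - y)^-1) => k.
rewrite -yy exprMn exprSr mulrACA; apply: ler_pM => //.
- by rewrite mulr_ge0 ?exprn_ge0 // ler0n.
- by rewrite mulr_ge0 ?exprn_ge0 // ler0n.
- exact: natmul_geometric_le.
Qed.

Lemma poly_geometric_small (j : nat) (x delta : R) (N : nat) :
  0 <= x < 1 -> 0 < delta ->
  exists k : nat, [/\ (N <= k)%N, (0 < k)%N & k%:R ^+ j * x ^+ k <= delta].
Proof.
move=> x01 d0; have [M hM] := poly_geometric_bounded j.+1 x01.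
pose k := (maxn N (Num.truncn (M / delta))).+1.
exists k; split => //; first by rewrite /k; lia.
have Mk : M / delta < k%:R.
  apply: lt_le_trans (truncnS_gt _) _.
  by rewrite ler_nat /k ltnS leq_maxr.
have k0 : 0 < k%:R :> R by rewrite ltr0n.
have := hM k; rewrite exprS -mulrA => h.
rewrite -(ler_pM2l k0); apply: le_trans h _.
by move: Mk; rewrite ltr_pdivrMr // => /ltW.
Qed.

Lemma scale_exists (d : nat) (eps delta : R) (N : nat) :
  0 < eps -> eps <= 1 -> 0 < delta ->
  exists k : nat, [/\ (N <= k)%N, (0 < k)%N,
   ((2 * (2 * (k * k)) + 1) ^ d < 2 ^ k)%N &
   (k * (2 * (2 * (k * k)) + 1) ^ d)%:R * (1 - eps) ^+ k <= delta].
Proof.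
move=> e0 e1 d0.
(* One geometric rate serves both for the error term and for the growth of 2 ^ k. *)
pose x := Num.max (1 - eps) 2^-1.
pose del := Num.min delta 2^-1 / 5 ^+ d.
have x01 : 0 <= x < 1.
  rewrite /x le_max gt_max invr_ge0 ler0n orbT /=.
  by apply/andP; split; lra.
have p5 : 0 < 5 ^+ d :> R by rewrite exprn_gt0.
have del0 : 0 < del by rewrite divr_gt0 // lt_min d0 invr_gt0 ltr0n.
have [k [Nk k0 hk]] := poly_geometric_small (2 * d).+1 N x01 del0.
have k1 : 1 <= k%:R :> R by rewrite ler1n.
have bound : (k * (2 * (2 * (k * k)) + 1) ^ d)%:R * x ^+ k <= Num.min delta 2^-1.
  apply: (@le_trans _ _ (5 ^+ d * (k%:R ^+ (2 * d).+1 * x ^+ k))); last first.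
    by rewrite mulrC -ler_pdivlMr.
  rewrite mulrA; apply: ler_wpM2r; first by apply: exprn_ge0; case/andP: x01.
  rewrite natrM natrX exprS exprM mulrCA ler_wpM2l // -exprMn.
  by apply: lerXn2r; rewrite ?nnegrE ?ler0n ?mulr_ge0 ?exprn_ge0 ?ler0n //;
    rewrite natrD !natrM; nra.
have xx : 0 <= (1 - eps) ^+ k <= x ^+ k.
  apply/andP; split; first by rewrite exprn_ge0 // subr_ge0.
  by apply: lerXn2r; rewrite ?nnegrE /x ?le_max ?subr_ge0 ?e1 ?lexx.
have hx : 2^-1 ^+ k <= x ^+ k.
  by apply: lerXn2r; rewrite ?nnegrE /x ?le_max ?invr_ge0 ?ler0n ?lexx ?orbT.
exists k; split => //.
- rewrite -(ltr_nat R) natrX [ltRHS]natrX.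
  rewrite -[ltRHS]mul1r -ltr_pdivrMr ?exprn_gt0 // -exprVn.
  apply: (@le_lt_trans _ _ 2^-1); last by rewrite invf_lt1 ?ltr1n ?ltr0n.
  apply: (@le_trans _ _ (Num.min delta 2^-1)); last by rewrite ge_min lexx orbT.
  apply: le_trans bound; rewrite -natrX.
  apply: ler_pM; rewrite ?exprn_ge0 ?invr_ge0 ?ler0n //.
  by rewrite ler_nat; exact: leq_pmull.
- apply: (@le_trans _ _ (Num.min delta 2^-1)); last by rewrite ge_min lexx.
  apply: le_trans bound; apply: ler_wpM2l => //.
  by case/andP: xx.
Qed.
End asymptotics.

(** The scale n depends on eps, d and delta only.  The lower bound N serves
    to let the scale tend to infinity. *)
Lemma ball_connected (R : realType) (d : nat) (hd : (2 <= d)%N)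
    (eps delta : R) (N : nat) :
  0 < eps -> eps <= 1 -> 0 < delta ->
  exists2 n : nat, (N < n)%N &
  forall (X : set (edge d)) (c : vertex d) (disp : measure_display)
    (T : measurableType disp) (P : probability T R)
    (omega : T -> set (edge d)),
  everywhere_percolating X -> bernoulli_percolation P eps omega ->
  let E := [set v | forall x y, ball c n x -> ball c n y ->
    connected_in (X `|` omega v) (ball c (2 * n)) x y] in
  measurable E /\ ((1 - delta)%:E <= P E)%E.
Proof.
move=> e0 e1 d0; have [k [Nk k0 big small]] := scale_exists d N.+1 e0 e1 d0.
exists (k * k)%N; first by nia.
move=> X c disp T P omega perX bern E.
have [mE PE] := ball_connected_prob hd c perX bern big.
split => //; apply: le_trans PE; rewrite lee_fin.
by rewrite lerD2l lerN2.
Qed.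

(** * Percolation of independent edges in the quadrant *)

Definition site := (nat * nat)%type.
Definition bond := (nat * nat * bool)%type.
Definition bond1 (e : bond) : site := e.1.
Definition bond2 (e : bond) : site :=
  if e.2 then (e.1.1, e.1.2.+1) else (e.1.1.+1, e.1.2).

Inductive quadrant_reach (O : set bond) (u : site) : site -> Prop :=
| reach_refl : quadrant_reach O u u
| reach_forward e : O e -> quadrant_reach O u (bond1 e) ->
    quadrant_reach O u (bond2 e)
| reach_backward e : O e -> quadrant_reach O u (bond2 e) ->
    quadrant_reach O u (bond1 e).

Definition plaquette (i j : nat) : seq bond :=
  [:: (i, j, false); (i.+1, j, true); (i, j.+1, false); (i, j, true)].

(** The bonds that share a plaquette with e, with repetitions.  On the border of
    the quadrant the missing plaquette is replaced by the other one, because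
    0.-1 = 0; this only adds repetitions. *)
Definition dual_neighbours (e : bond) : seq bond :=
  plaquette e.1.1 e.1.2 ++
  if e.2 then plaquette e.1.1.-1 e.1.2 else plaquette e.1.1 e.1.2.-1.

Lemma plaquette_neighbours i j e f :
  e \in plaquette i j -> f \in plaquette i j -> f \in dual_neighbours e.
Proof.
move=> eP fP; rewrite !inE in eP; rewrite /dual_neighbours mem_cat.
by case/or4P: eP => /eqP ->; apply/orP; [left|right|right|left]; exact: fP.
Qed.

Lemma dual_neighbours_abscissa e f : f \in dual_neighbours e ->
  (e.1.1 <= f.1.1.+1)%N.
Proof.
rewrite mem_cat; case: e => -[a b] [] /=; rewrite !inE => /orP[] /or4P[] /eqP -> /=; lia.
Qed.

Arguments dual_neighbours : simpl never.

Section separation.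
Variables (C : set site) (r M : nat).
Hypotheses (C_bottom : forall a, (a <= r)%N -> C (a, 0%N))
  (C_finite : forall v, C v -> (v.1 < M)%N /\ (v.2 < M)%N).

Definition cut (e : bond) : bool := `[< C (bond1 e) >] (+) `[< C (bond2 e) >].

(** The part of the cut that is dual-connected to the bottom row. *)
Definition below_cut (e : bond) : bool :=
  `[< exists x s, [/\ path (fun f g => g \in dual_neighbours f) (x, 0%N, false) s,
     all cut ((x, 0%N, false) :: s) & last (x, 0%N, false) s = e] >].

Lemma below_cut_cut e : below_cut e -> cut e.
Proof. by move=> /asboolP[x [s [_ /allP h <-]]]; apply: h; exact: mem_last. Qed.

Lemma below_cut_step e f : below_cut e -> f \in dual_neighbours e -> cut f ->
  below_cut f.
Proof.
move=> /asboolP[x [s [ps cs le]]] ef cf; apply/asboolP; exists x, (rcons s f).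
rewrite rcons_path ps le ef last_rcons; split => //.
by rewrite -rcons_cons all_rcons cf.
Qed.

Lemma below_cut_bottom x : below_cut (x, 0%N, false) = cut (x, 0%N, false).
Proof.
apply/idP/idP; first exact: below_cut_cut.
by move=> cx; apply/asboolP; exists x, [::]; rewrite /= cx.
Qed.

(** A cut meets each plaquette in an even number of bonds, and these bonds
    are neighbours of each other: they are all below the cut or none is. *)
Lemma below_cut_plaquette i j :
  below_cut (i, j, false) (+) below_cut (i, j.+1, false) =
  below_cut (i, j, true) (+) below_cut (i.+1, j, true).
Proof.
have [[e eP be]|none] := pselect (exists2 e, e \in plaquette i j & below_cut e).
  have E f : f \in plaquette i j -> below_cut f = cut f.
    move=> fP; apply/idP/idP; first exact: below_cut_cut.
    by apply: below_cut_step be _; exact: plaquette_neighbours fP.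
  rewrite !E ?inE ?eqxx ?orbT // /cut /bond1 /bond2 /=.
  by case: `[< _ >]; case: `[< _ >]; case: `[< _ >]; case: `[< _ >].
have E f : f \in plaquette i j -> below_cut f = false.
  by move=> fP; apply/negP => bf; apply: none; exists f.
by rewrite !E ?inE ?eqxx ?orbT.
Qed.

Definition row_parity (j n : nat) : bool :=
  \big[addb/false]_(i < n) below_cut (i : nat, j, false).

(** Summing the parity of the plaquettes between two rows leaves only the two
    vertical bonds at the ends. *)
Lemma row_parityS j n : row_parity j n (+) row_parity j.+1 n =
  below_cut (0%N, j, true) (+) below_cut (n, j, true).
Proof.
elim: n => [|n IH]; first by rewrite /row_parity !big_ord0 !addbb.
rewrite /row_parity !big_ord_recr /= -/(row_parity j n) -/(row_parity j.+1 n).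
have := below_cut_plaquette n j; move: IH.
case: (row_parity j n); case: (row_parity j.+1 n); case: (below_cut (n, j, false));
 case: (below_cut (n, j.+1, false)); case: (below_cut (0%N, j, true));
 case: (below_cut (n, j, true)); by case: (below_cut (n.+1, j, true)).
Qed.

Lemma outside_right j : ~ C (M, j).
Proof. by move=> /C_finite[]; rewrite /= ltnn. Qed.

Lemma outside_top i : ~ C (i, M).
Proof. by move=> /C_finite[_]; rewrite /= ltnn. Qed.

Lemma row_parity0 : row_parity 0 M = true.
Proof.
have H n : row_parity 0 n = ~~ `[< C (n, 0%N) >].
  elim: n => [|n IH]; rewrite /row_parity ?big_ord0 ?big_ord_recr /=.
    by rewrite asboolT //; exact: C_bottom.
  rewrite -/(row_parity 0 n) IH below_cut_bottom /cut /bond1 /bond2 /=.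
  by case: `[< _ >]; case: `[< _ >].
by rewrite H asboolF //; exact: outside_right.
Qed.

Lemma row_parityM : row_parity M M = false.
Proof.
rewrite /row_parity big1 // => i _; apply/negbTE/negP => /below_cut_cut.
by rewrite /cut /bond1 /bond2 /= !asboolF //; exact: outside_top.
Qed.

(** The bottom row crosses the cut an odd number of times, as it goes from
    C to its complement, and the top row does not cross it.  This change of
    parity can only happen through the left side, since the right side is
    outside C.  No planar topology is involved beyond this homological
    count. *)
Lemma below_cut_reaches_left : exists j, below_cut (0%N, j, true).
Proof.
apply: contrapT => none.
have H j : row_parity j M = row_parity j.+1 M.
  have := row_parityS j M.
  have -> : below_cut (0%N, j, true) = false.
    by apply/negP => h; apply: none; exists j.
  have -> : below_cut (M, j, true) = false.
    apply/negbTE/negP => /below_cut_cut.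
    by rewrite /cut /bond1 /bond2 /= !asboolF //; exact: outside_right.
  by case: (row_parity j M); case: (row_parity j.+1 M).
have H' j : row_parity j M = true.
  by elim: j => [|j IH]; [exact: row_parity0|rewrite -H].
by have := row_parityM; rewrite H'.
Qed.

Lemma abscissa_le_size e s : path (fun f g => g \in dual_neighbours f) e s ->
  (e.1.1 <= (last e s).1.1 + size s)%N.
Proof.
elim: s e => [|f s IH] e /=; first by rewrite addn0.
move=> /andP[/dual_neighbours_abscissa ef /IH IHs].
by apply: leq_trans ef _; rewrite addnS ltnS.
Qed.

(** The dual path has to travel from abscissa x >= r to abscissa 0, at speed at
    most 1; its first x bonds are kept. *)
Lemma dual_path_exists : exists x s, [/\ (r <= x)%N, size s = x,
  path (fun f g => g \in dual_neighbours f) (x, 0%N, false) s, uniq s &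
  all cut s].
Proof.
have [j /asboolP[x [s [ps cs ls]]]] := below_cut_reaches_left.
have rx : (r <= x)%N.
  rewrite leqNgt; apply/negP => xr.
  move: cs => /= /andP[+ _]; rewrite /cut /bond1 /bond2 /= !asboolT //;
    by apply: C_bottom => //; exact: ltnW.
case/shortenP: ps ls => t pt ut st lt.
have tx : (x <= size t)%N by have := abscissa_le_size pt; rewrite lt.
exists x, (take x t); split => //.
- by rewrite size_takel.
- exact: take_path.
- by apply: take_uniq; case/andP: ut.
- apply/allP => f /mem_take /st fs; move/allP: cs; apply.
  by rewrite inE fs orbT.
Qed.
End separation.

Lemma cut_closed (O : set bond) (A : set site) (e : bond) :
  cut [set v | exists2 a, A a & quadrant_reach O a v] e -> ~ O e.
Proof.
move=> + Oe; rewrite /cut; case: asboolP => [[a Aa a1]|n1]; case: asboolP => //.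
  by move=> n2; case: n2; exists a => //; exact: reach_forward.
by move=> [a Aa a2]; case: n1; exists a => //; exact: reach_backward.
Qed.

Fixpoint dual_walks (n : nat) (e : bond) : seq (seq bond) :=
  if n is n'.+1 then
    flatten [seq [seq f :: s | s <- dual_walks n' f] | f <- dual_neighbours e]
  else [:: [::]].

Lemma dual_walksS n e : dual_walks n.+1 e =
  flatten [seq [seq f :: s | s <- dual_walks n f] | f <- dual_neighbours e].
Proof. by []. Qed.

Lemma mem_dual_walks e s : path (fun f g => g \in dual_neighbours f) e s ->
  s \in dual_walks (size s) e.
Proof.
elim: s e => [//|f s IH] e; rewrite [path _ _ _]/= => /andP[ef ps].
rewrite [size _]/= dual_walksS; apply/flattenP; exists [seq f :: t | t <- dual_walks (size s) f].
  exact: (map_f (fun g => [seq g :: t | t <- dual_walks (size s) g])).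
by apply: map_f; exact: IH.
Qed.

Lemma size_dual_walks n e : size (dual_walks n e) = (8 ^ n)%N.
Proof.
elim: n e => [//|n IH] e; rewrite dual_walksS.
have E s : size (flatten [seq [seq f :: t | t <- dual_walks n f] | f <- s]) =
    (size s * 8 ^ n)%N.
  by elim: s => //= f s IHs; rewrite size_cat size_map IH IHs mulSn.
by rewrite E expnS; case: e => [[a b] []].
Qed.

Section peierls.
Variables (R : realType) (disp : measure_display) (T : measurableType disp)
  (P : probability T R) (Z : T -> set bond) (p : R).
Hypotheses (mZ : random_set Z) (pZ : forall e, P [set w | Z w e] = p%:E)
  (iZ : mutually_independent P (fun e => [set w | Z w e]))
  (p_large : 1 - 16^-1 <= p).

Definition closed_dual_walk (x : nat) : set T :=
  [set w | exists2 s, s \in dual_walks x (x, 0%N, false) &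
     [/\ uniq s, size s = x & forall e, e \in s -> ~ Z w e]].

(** There are at most 8 ^ x walks, each closed with probability at most
    16 ^- x.  The bound is put in the form of a geometric series
    with sum 2. *)
Lemma closed_dual_walk_prob x : measurable (closed_dual_walk x) /\
  (P (closed_dual_walk x) <= (2 / (2 ^ x.+1)%:R)%:E)%E.
Proof.
have p1 : p <= 1 by rewrite -lee_fin -(pZ (0%N, 0%N, false)) probability_le1.
pose F (s : seq bond) : set T :=
  [set w | [/\ uniq s, size s = x & forall e, e \in s -> ~ Z w e]].
have FP s : measurable (F s) /\ (P (F s) <= (16^-1 ^+ x)%:E)%E.
  have [|ns] := pselect (uniq s /\ size s = x); last first.
    have -> : F s = set0 by apply/seteqP; split=> w // [? ? _]; apply: ns.
    by rewrite measure0 lee_fin; split => //; rewrite exprn_ge0 // invr_ge0.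
  move=> [us sx].
  have FE : F s = \bigcap_(e in [set` [fset f in s]%fset]) ~` [set w | Z w e].
    apply/seteqP; split=> w.
      by move=> [_ _ h] e /=; rewrite !inE => es; exact: h.
    by move=> h; split => // e es; apply: (h e); rewrite /= !inE.
  split.
    rewrite FE; apply: fin_bigcap_measurable => [|e _]; first exact: finite_fset.
    exact: measurableC.
  rewrite FE mutually_independentC //.
  under eq_bigr do rewrite pZ -EFinB.
  rewrite prodEFin lee_fin big_const_seq count_predT iter_mulr_1.
  rewrite card_fseq undup_id // sx.
  apply: lerXn2r; rewrite ?nnegrE ?subr_ge0 ?invr_ge0 //.
  by rewrite lerBlDl -lerBlDr.
have [mU PU] := @union_bound R disp T P _ (dual_walks x (x, 0%N, false)) F
  (fun s => (FP s).1).
split => //; apply: le_trans PU _.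
apply: (@le_trans _ _ (\sum_(s <- dual_walks x (x, 0%N, false)) (16^-1 ^+ x)%:E)%E).
  by apply: lee_sum => s _; exact: (FP s).2.
rewrite sumEFin lee_fin big_const_seq count_predT iter_addr_0 size_dual_walks.
rewrite -[leLHS]mulr_natl natrX -exprMn.
rewrite expnS natrM invfM mulrA divff // mul1r natrX -exprVn.
by rewrite (_ : 8%:R * 16^-1 = 2^-1 :> R) //; field.
Qed.

(** By the Borel-Cantelli lemma there are almost surely closed dual walks from
    only finitely many points of the bottom row.  If all clusters were finite,
    the union of the clusters of an arbitrarily long bottom segment would be
    finite and surrounded by such a walk. *)
Lemma quadrant_percolation : exists N : set T, [/\ measurable N, P N = 0%E &
  forall w, ~ N w -> exists u, infinite_set [set v | quadrant_reach (Z w) u v]].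
Proof.
exists (lim_sup_set closed_dual_walk).
have mB k : measurable (closed_dual_walk k) by exact: (closed_dual_walk_prob k).1.
split.
- apply: bigcap_measurable => // n _.
  by apply: bigcup_measurable => k _.
- apply: lim_sup_set_cvg0 => //.
  apply: (@le_lt_trans _ _ (2%:E)); last exact: ltry.
  apply: le_trans (epsilon_trick0 _ _) => //.
  apply: lee_nneseries => // k _; exact: (closed_dual_walk_prob k).2.
move=> w nw; apply: contrapT => none; apply: nw => r _.
pose A := [set v : site | (v.1 <= r)%N /\ v.2 = 0%N].
pose C := [set v | exists2 a, A a & quadrant_reach (Z w) a v].
have finA : finite_set A.
  apply: (@sub_finite_set _ _ (`I_r.+1 `*` `I_1)).
    by move=> v [v1 v2]; split; rewrite /= ?v2 ?ltnS.
  by apply: finite_setX; exact: finite_II.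
have finC : finite_set C.
  have -> : C = \bigcup_(a in A) [set v | quadrant_reach (Z w) a v].
    by apply/seteqP; split=> v [a]; exists a.
  apply: bigcup_finite => // a _.
  by apply: contrapT => h; apply: none; exists a.
have [M hM] : exists M, forall v, C v -> (v.1 < M)%N /\ (v.2 < M)%N.
  exists (\max_(v <- fset_set C) (v.1 + v.2)).+1 => v Cv.
  have : (v.1 + v.2 <= \max_(v <- fset_set C) (v.1 + v.2))%N.
    by apply: (@leq_bigmax_seq _ _ xpredT (fun v => v.1 + v.2)%N) => //;
      rewrite in_fset_set //; exact/mem_set.
  lia.
have [|x [s [rx sx ps us cs]]] := @dual_path_exists C r M _ hM.
  by move=> a ar; exists (a, 0%N) => //; exact: reach_refl.
exists x => //; exists s; first by rewrite -{1}sx; exact: mem_dual_walks.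
split => // e es; apply: cut_closed; move/allP: cs; exact.
Qed.
End peierls.

(** * Domination of independent percolation by renormalized edges *)

Section superposition.
Variables (R : realType) (K : finType) (I : choiceType).
Variables (disp : measure_display) (T : measurableType disp)
  (P : probability T R) (Z : T -> set (K * I)%type) (a : I -> R).
Hypotheses (mZ : random_set Z)
  (pZ : forall k i, P [set w | Z w (k, i)] = (a i)%:E)
  (iZ : mutually_independent P (fun ki => [set w | Z w ki])).

(** The union of the layers Z w (k, _), one for each colour k. *)
Definition superposition (w : T) : set I := [set i | exists k, Z w (k, i)].

Lemma random_superposition : random_set superposition.
Proof. by move=> i; apply: measurable_exists => k; exact: mZ. Qed.

Lemma superposition_prob i :
  P [set w | superposition w i] = (1 - (1 - a i) ^+ #|K|)%:E.
Proof.
have -> : [set w | superposition w i] = ~` [set w | ~ superposition w i].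
  by rewrite -[in LHS](setCK [set w | superposition w i]).
pose J := [fset (k, i) | k in K]%fset.
have JE : [set w | ~ superposition w i] =
    \bigcap_(ki in [set` J]) ~` [set w | Z w ki].
  apply/seteqP; split=> w.
    by move=> h _ /imfsetP[k _ ->] Zk; apply: h; exists k.
  by move=> h [k Zk]; apply: (h (k, i)) => //=; apply/imfsetP; exists k.
rewrite probability_setC; last by apply: measurable_neg; exact: random_superposition.
rewrite JE mutually_independentC // big_imfset /=; last by move=> ? ? _ _ [].
under eq_bigr do rewrite pZ -EFinB.
rewrite prodEFin -EFinB; congr (1 - _)%:E.
by rewrite big_const_seq count_predT iter_mulr_1 -cardE.
Qed.

Lemma superposition_independent :
  mutually_independent P (fun i => [set w | superposition w i]).
Proof.
have h := @indep_blocks R _ disp T P Z mZ iZ I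
  (fun i => [set ki | ki.2 = i]) (fun i => [set S | exists k, S (k, i)]).
have eE i : (fun w => Z w `&` [set ki | ki.2 = i]) @^-1`
    [set S | exists k, S (k, i)] = [set w | superposition w i].
  by apply/seteqP; split=> w [k]; [move=> [Zk _]; exists k|exists k].
move=> J; under eq_bigr do rewrite -eE.
rewrite -[RHS]h //.
- by congr (P _); apply: eq_bigcapr => i _; rewrite eE.
- move=> i j ij; apply/seteqP; split=> -[k l] // [/= -> ijE].
  by rewrite ijE eqxx in ij.
- by move=> i; apply: measurable_exists => k; exact: measurable_cyl.
Qed.
End superposition.

Section colouring.
Variable d : nat.
Implicit Types e f : edge d.

Definition colour := ({ffun 'I_d -> 'I_3} * 'I_d)%type.

Definition colour_of e : colour :=
  ([ffun j => inord (absz (modz (e.1 0%R j) 3))], e.2).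

Definition centre (n : nat) e : vertex d := (endpoint1 e + endpoint2 e) *+ n.

Lemma centreE n e j :
  centre n e 0 j = n%:Z * (2 * e.1 0 j + (j == e.2)%:R).
Proof.
rewrite /centre mulmxnE mxE endpoint2E /endpoint1 -[LHS]mulr_natl natz.
by congr (_ * _); ring.
Qed.

(** Edges of one colour have the same direction and base points congruent
    modulo 3, so distinct ones have centres at distance at least 6n, more than
    the sum 4n of the radii. *)
Lemma colour_disjoint n e f z : (0 < n)%N -> colour_of e = colour_of f ->
  ball (centre n e) (2 * n) z -> ball (centre n f) (2 * n) z -> e = f.
Proof.
move=> n0 ef /rho_leP ez /rho_leP fz.
case: ef => /ffunP ef1 ef2.
case: e f ef1 ef2 ez fz => [x i] [y i'] /= ef1 ef2 ez fz; subst i'.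
congr (_, _); apply/rowP => j; move: (ef1 j); rewrite !ffunE /=.
move/(congr1 val) => /=; rewrite !inordK; try lia.
move=> xy; move: (ez j) (fz j); rewrite !centreE /=.
set A := 2 * x 0 j + _; set B := 2 * y 0 j + _ => zA zB.
have AB : A - B = 2 * (x 0 j - y 0 j) by rewrite /A /B; ring.
(* Distinct centres differ by at least 6n in the coordinate j. *)
have far (u v : int) : u + 6 <= v -> n%:Z * u + n%:Z * 6 <= n%:Z * v.
  by rewrite -mulrDr; apply: ler_wpM2l.
have [AB6|AB6] : A + 6 <= B \/ B + 6 <= A \/ x 0 j = y 0 j by lia.
  by have := far _ _ AB6; lia.
by case: AB6 => [/far|//]; lia.
Qed.

End colouring.

Lemma superposition_root (R : realType) (eps : R) (K : nat) :
  0 < eps -> eps <= 1 -> (0 < K)%N ->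
  exists e : R, [/\ 0 < e, e <= 1 & 1 - (1 - e) ^+ K = eps].
Proof.
move=> e0 e1 K0; have e1' : 0 <= 1 - eps by rewrite subr_ge0.
pose y := (1 - eps) `^ (K%:R^-1).
have yK : y ^+ K = 1 - eps.
  rewrite -powR_mulrn ?powR_ge0 // -powRrM mulVf ?powRr1 //.
  by rewrite pnatr_eq0 -lt0n.
have y0 : 0 <= y by exact: powR_ge0.
have y1 : y < 1.
  rewrite ltNge; apply/negP => /(exprn_ege1 K); rewrite yK; lra.
exists (1 - y); split; [lra|lra|].
by rewrite subKr yK subKr.
Qed.

Section good_blocks.
Variables (R : realType) (d : nat) (X : set (edge d)) (n : nat).
Hypothesis n0 : (0 < n)%N.

Definition inside (c : vertex d) (r : nat) : set (edge d) :=
  [set f | ball c r (endpoint1 f) /\ ball c r (endpoint2 f)].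

(** For each colour, a layer of omega (left summand) and a layer of eta (right
    summand). *)
Definition bit := (colour d * (edge d + edge d))%type.

Definition sprinkled (k : colour d) (S : set bit) : set (edge d) :=
  [set f | S (k, inl f)].

(** The block of e looks only at the layers of its own colour. *)
Definition good_block (e : edge d) : set (setspace bit) :=
  [set S | (forall x y, ball (centre n e) n x -> ball (centre n e) n y ->
      connected_in (X `|` sprinkled (colour_of e) S) (ball (centre n e) (2 * n)) x y) /\
    forall f, inside (centre n e) (2 * n) f -> S (colour_of e, inr f)].

Definition block_bits (e : edge d) : set bit :=
  [set b | b.1 = colour_of e /\
     inside (centre n e) (2 * n) (match b.2 with inl f => f | inr f => f end)].

Lemma block_bits_disjoint e f : e != f -> block_bits e `&` block_bits f = set0.
Proof.
move=> ef; apply/seteqP; split=> -[k b] // [[/= -> [be _]] [/= kf [bf _]]].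
by have := colour_disjoint n0 kf be bf; move/eqP; rewrite (negbTE ef).
Qed.

Lemma measurable_good_block e : measurable (good_block e).
Proof.
apply: measurable_conj.
  apply: measurable_forall => x; apply: measurable_forall => y.
  apply: measurable_impl; first exact: measurable_cst.
  apply: measurable_impl; first exact: measurable_cst.
  apply: measurable_connected_in; apply: random_set_setUl => f.
  exact: measurable_cyl.
apply: measurable_forall => f; apply: measurable_impl; first exact: measurable_cst.
exact: measurable_cyl.
Qed.

Lemma good_block_local e S : good_block e S -> good_block e (S `&` block_bits e).
Proof.
move=> [h1 h2]; split=> [x y xn yn|f fi].
  apply: connected_in_sub (h1 x y xn yn) => // f f1 f2 [Xf|Sf]; first by left.
  by right; split => //=; split.
by split; [exact: h2|split].
Qed.

Lemma centre_endpoints (e : edge d) : ball (centre n e) n (endpoint1 e *+ (2 * n)) /\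
  ball (centre n e) n (endpoint2 e *+ (2 * n)).
Proof.
have E (a : int) : a *+ (2 * n) = (2 * n)%:Z * a by rewrite -mulr_natl natz.
by split; apply/rho_leP => j; rewrite centreE mulmxnE E ?endpoint2E /endpoint1;
  case: (j == e.2); rewrite /= PoszM; lia.
Qed.

Lemma good_block_connected e S : good_block e S ->
  connected_in ((X `|` [set f | exists k, S (k, inl f)]) `&`
      [set f | exists k, S (k, inr f)])
    (ball (centre n e) (2 * n)) (endpoint1 e *+ (2 * n)) (endpoint2 e *+ (2 * n)).
Proof.
move=> [h1 h2]; have [b1 b2] := centre_endpoints e.
apply: connected_in_sub (h1 _ _ b1 b2) => // f f1 f2 Xf; split.
  by case: Xf => [|Sf]; [left|right; exists (colour_of e)].
by exists (colour_of e); apply: h2.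
Qed.

Variables (disp : measure_display) (T : measurableType disp)
  (P : probability T R) (Z : T -> set bit) (eps' q' delta : R).
Hypotheses (mZ : random_set Z)
  (pZl : forall k f, P [set w | Z w (k, inl f)] = eps'%:E)
  (pZr : forall k f, P [set w | Z w (k, inr f)] = q'%:E)
  (iZ : mutually_independent P (fun b => [set w | Z w b])).

Lemma sprinkled_bernoulli k :
  bernoulli_percolation P eps' (fun w => sprinkled k (Z w)).
Proof.
split; [by move=> f; exact: mZ|by move=> f; exact: pZl|].
by apply: (mutually_independent_inj (g := fun f => (k, inl f)) _ iZ) => f g [].
Qed.

Hypothesis d0 : (0 < d)%N.
Hypothesis connect_large : forall e k,
  ((1 - delta)%:E <= P [set v | forall x y, ball (centre n e) n x ->
    ball (centre n e) n y ->
    connected_in (X `|` sprinkled k (Z v)) (ball (centre n e) (2 * n)) x y])%E.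

Lemma good_block_prob e : measurable [set w | good_block e (Z w)] /\
  ((1 - delta - ((2 * (2 * n) + 1) ^ d * d)%:R * (1 - q'))%:E <=
    P [set w | good_block e (Z w)])%E.
Proof.
have mE := random_set_preimage mZ (measurable_good_block e).
split => //.
have q1 : 0 <= 1 - q'.
  rewrite subr_ge0 -lee_fin.
  by rewrite -(pZr (colour_of e) (0, Ordinal d0)) probability_le1.
set c := centre n e; set k := colour_of e.
pose E1 := [set v | forall x y, ball c n x -> ball c n y ->
    connected_in (X `|` sprinkled k (Z v)) (ball c (2 * n)) x y].
have mE1 : measurable E1.
  apply: measurable_forall => x; apply: measurable_forall => y.
  apply: measurable_impl; first exact: measurable_cst.
  apply: measurable_impl; first exact: measurable_cst.
  by apply: measurable_connected_in; apply: random_set_setUl => f; exact: mZ.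
pose A := fset_set (ball c (2 * n)).
have inA z : (z \in A) = (rho c z <= 2 * n)%N.
  rewrite in_fset_set; last exact: finite_ball.
  by apply/idP/idP => [/set_mem|h]; [|apply/mem_set].
have sA : (size A <= (2 * (2 * n) + 1) ^ d)%N.
  by apply: (@ball_size d c) => [|z]; [exact: fset_uniq|rewrite inA].
pose s : seq (edge d) := [seq (x, i) | x <- A, i <- enum 'I_d].
pose F (f : edge d) : set T := ~` [set v | Z v (k, inr f)].
have mF f : measurable (F f) by apply: measurableC; exact: mZ.
have [mU PU] := @union_bound R disp T P _ s F mF.
set U := [set w | _] in mU PU.
have PU' : (P U <= (((2 * (2 * n) + 1) ^ d * d)%:R * (1 - q'))%:E)%E.
  apply: le_trans PU _.
  under eq_bigr do rewrite probability_setC ?pZr -?EFinB //.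
  rewrite sumEFin lee_fin big_const_seq count_predT iter_addr_0 -[leLHS]mulr_natl.
  apply: ler_wpM2r => //; rewrite ler_nat size_allpairs -cardE card_ord.
  by rewrite leq_mul2r sA orbT.
have sub : E1 `\` U `<=` [set w | good_block e (Z w)].
  move=> v [h1 nU]; split => // f [f1 f2]; apply: contrapT => nf; apply: nU.
  exists f => //; rewrite /s [f]surjective_pairing; apply: allpairs_f.
    by rewrite inA.
  by rewrite mem_enum.
apply: (@le_trans _ _ (P (E1 `\` U))); last first.
  by apply: le_measure; rewrite ?inE //; exact: measurableD.
have : (P E1 <= P (E1 `\` U) + P U)%E.
  apply: le_trans (measureU2 _ _ _) => //; last exact: measurableD.
  apply: le_measure; rewrite ?inE //.
    by apply: measurableU => //; exact: measurableD.
  by move=> v Ev; have [?|?] := pselect (U v); [right|left].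
have fD : P (E1 `\` U) \is a fin_num by apply: fin_num_measure; exact: measurableD.
have fU : P U \is a fin_num by exact: fin_num_measure.
have f1 : P E1 \is a fin_num by exact: fin_num_measure.
move: (connect_large e k); rewrite -/c -/E1.
move: PU'; rewrite -(fineK fD) -(fineK fU) -(fineK f1) -EFinD !lee_fin.
move=> h1 h2 h3; lra.
Qed.

Lemma good_blocks_independent :
  mutually_independent P (fun e => [set w | good_block e (Z w `&` block_bits e)]).
Proof.
apply: (indep_blocks mZ iZ (G := block_bits) (A := good_block)).
  exact: block_bits_disjoint.
exact: measurable_good_block.
Qed.

End good_blocks.

(** The pair (omega, eta) as one independent family, omega being indexed by
    the left summand. *)
Definition joint_percolation (R : realType) (d : nat) (disp : measure_display)
    (T : measurableType disp) (P : probability T R) (eps q : R)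
    (Z : T -> set (edge d + edge d)%type) : Prop :=
  [/\ random_set Z, forall f, P [set w | Z w (inl f)] = eps%:E,
      forall f, P [set w | Z w (inr f)] = q%:E
    & mutually_independent P (fun i => [set w | Z w i])].

Definition joint_graph (d : nat) (X : set (edge d))
    (S : set (edge d + edge d)%type) : set (edge d) :=
  (X `|` [set f | S (inl f)]) `&` [set f | S (inr f)].

(** The density of a layer of eta; the union of the K layers still has density
    less than 1. *)
Lemma block_parameter (R : realType) (p : R) (K N : nat) :
  0 <= p < 1 -> (0 < K)%N -> (0 < N)%N ->
  exists q : R, [/\ 0 <= q, q <= 1, 0 <= 1 - (1 - q) ^+ K < 1 &
    p <= 1 - (1 - p) / 2 - N%:R * (1 - q)].
Proof.
move=> /andP[p0 p1] K0 N0.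
have N1 : 1 <= N%:R :> R by rewrite ler1n.
pose t := (1 - p) / 2 / N%:R.
have t0 : 0 < t by rewrite divr_gt0 ?ltr0n // divr_gt0 // subr_gt0.
have t1 : t <= 1.
  by rewrite /t ler_pdivrMr ?ltr0n // mul1r; lra.
have tN : N%:R * t = (1 - p) / 2.
  by rewrite /t mulrCA divff ?mulr1 // pnatr_eq0 -lt0n.
exists (1 - t); rewrite subKr tN.
split; [lra|lra| |lra].
rewrite subr_ge0 exprn_ile1 //=; last exact: ltW.
by rewrite ltrBlDr ltrDl exprn_gt0.
Qed.

(** Z is the superposition of the layers, and Z' keeps the good blocks after an
    independent thinning.  The scale n and the density q do not depend
    on X. *)
Lemma coupling (R : realType) (d : nat) (hd : (2 <= d)%N) (eps p : R) :
  0 < eps -> eps <= 1 -> 0 <= p < 1 ->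
  exists (n : nat) (q : R), [/\ (0 < n)%N, 0 <= q < 1 &
  forall X : set (edge d), everywhere_percolating X ->
  exists (disp : measure_display) (T : measurableType disp)
    (P : probability T R) (Z : T -> set (edge d + edge d)%type)
    (Z' : T -> set (edge d)),
  [/\ joint_percolation P eps q Z, bernoulli_percolation P p Z' &
    forall w e, Z' w e -> connected_in (joint_graph X (Z w))
      (ball (centre n e) (2 * n))
      (endpoint1 e *+ (2 * n)) (endpoint2 e *+ (2 * n))]].
Proof.
move=> e0 e1 p01; have /andP[p0 p1] := p01.
have d0 : (0 < d)%N by exact: ltnW.
have del0 : 0 < (1 - p) / 2 by rewrite divr_gt0 // subr_gt0.
have K0 : (0 < #|{: colour d}|)%N.
  by apply/card_gt0P; exists ([ffun=> ord0], Ordinal d0).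
have [eps' [e0' e1' eK]] := superposition_root e0 e1 K0.
have [n n0 hn] := ball_connected hd 0 e0' e1' del0.
have N0 : (0 < (2 * (2 * n) + 1) ^ d * d)%N by rewrite muln_gt0 d0 expn_gt0 addn1.
have [q' [q0' q1' q01 pq]] := block_parameter p01 K0 N0.
exists n, (1 - (1 - q') ^+ #|{: colour d}|); split => //.
move=> X perX.
(* All layers on one probability space, and the thinning variables on another one. *)
pose a (b : bit d) := match b.2 with inl _ => eps' | inr _ => q' end.
have [|disp0 [T0 [P0 [Z0 [mZ0 pZ0 iZ0]]]]] := @indep_family_exists R (bit d) a.
  by move=> [k [f|f]]; rewrite /a /= ?q0' ?q1' ?(ltW e0') ?e1'.
pose E e : set T0 := [set w | good_block X n e (Z0 w `&` block_bits n e)].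
have mE e : measurable (E e).
  exact: random_set_preimage (random_set_setI _ mZ0) (measurable_good_block X n e).
(* Each layer of omega is a Bernoulli percolation of density eps', to which the local estimate applies. *)
have pE e : (p%:E <= P0 (E e))%E.
  have [|mG PG] := @good_block_prob R d X n disp0 T0 P0 Z0 q' ((1 - p) / 2) mZ0
    (fun k f => pZ0 (k, inr f)) d0 _ e.
    move=> e' k; apply: (hn X _ disp0 T0 P0 _ perX _).2.
    by apply: sprinkled_bernoulli => // k' f; exact: pZ0 (k', inl f).
  apply: (@le_trans _ _ (P0 [set w | good_block X n e (Z0 w)])).
    by apply: le_trans PG; rewrite lee_fin.
  by apply: le_measure; rewrite ?inE // => w; exact: good_block_local.
have iE : mutually_independent P0 E by exact: good_blocks_independent.
pose r e := fine (P0 (E e)).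
have rE e : P0 (E e) = (r e)%:E by rewrite fineK // fin_num_measure.
have rp e : p <= r e by rewrite -lee_fin -rE.
have r0 e : 0 <= r e by exact: le_trans (rp e).
have [|disp1 [T1 [P1 [Z1 [mZ1 pZ1 iZ1]]]]] :=
  @indep_family_exists R (edge d) (fun e => p / r e).
  move=> e; rewrite divr_ge0 //=.
  have [->|re0] := eqVneq (r e) 0; first by rewrite invr0 mulr0 ler01.
  by rewrite ler_pdivrMr ?mul1r // lt_neqAle eq_sym re0 r0.
pose Z (w : T0 * T1) : set (edge d + edge d)%type :=
  [set i | superposition Z0 w.1 i].
pose Z' (w : T0 * T1) : set (edge d) := [set e | E e w.1 /\ Z1 w.2 e].
exists _, (T0 * T1)%type, (product_prob P0 P1), Z, Z'.
have mS i : measurable [set w | superposition Z0 w i].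
  exact: (random_superposition mZ0 i).
have mZ : random_set Z.
  by move=> i; exact: measurable_fst_preimage (mS i).
have pZ i : product_prob P0 P1 [set w | Z w i] = P0 [set w | superposition Z0 w i].
  by rewrite -(product_prob_fst P0 P1 (mS i)).
split; last 1 first.
- move=> w e [[h1 h2] _].
  have := good_block_connected n0 (conj h1 h2).
  apply: connected_in_sub => // f _ _ [h h']; split.
    by case: h => [|[k [Sk _]]]; [left|right; exists k].
  by case: h' => k [Sk _]; exists k.
- split => //.
  + by move=> f; rewrite pZ (superposition_prob (a := fun i =>
      match i with inl _ => eps' | inr _ => q' end) mZ0 _ iZ0) ?eK.
  + by move=> f; rewrite pZ (superposition_prob (a := fun i =>
      match i with inl _ => eps' | inr _ => q' end) mZ0 _ iZ0).
  move=> J; have := superposition_independent mZ0 iZ0 J.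
  under eq_bigr do rewrite -pZ.
  have mI : measurable (\bigcap_(i in [set` J]) [set w | superposition Z0 w i]).
    by apply: fin_bigcap_measurable => [|i _]; [exact: finite_fset|exact: mS].
  by move=> <-; rewrite -(product_prob_fst P0 P1 mI).
have Z'E e : [set w | Z' w e] = E e `*` [set w | Z1 w e] by [].
split.
- by move=> e; rewrite Z'E; exact: measurableX.
- move=> e; rewrite Z'E product_probE // rE pZ1 -EFinM.
  have [re0|re0] := eqVneq (r e) 0; last by rewrite mulrC divfK.
  by rewrite re0 mul0r; congr EFin; apply/le_anti; rewrite p0 -re0 rp.
- exact: (mutually_independent_prod (E2 := fun e => [set w | Z1 w e]) mE mZ1 iE iZ1).
Qed.

(** * Percolation of the sprinkled graph *)

Section quadrant_embedding.
Variables (d n : nat).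
Hypothesis hd : (2 <= d)%N.

(** The quadrant is embedded with all coordinates at least 1, so that the
    blocks, of radius 2n around points with coordinates at least 2n, have
    nonnegative coordinates. *)
Definition site_vertex (v : site) : vertex d :=
  \row_j (if j == 0%N :> nat then v.1%:Z + 1
          else if j == 1%N :> nat then v.2%:Z + 1 else 1).

Definition bond_direction (b : bool) : 'I_d :=
  if b then Ordinal hd else Ordinal (ltnW hd).

Definition bond_edge (e : bond) : edge d :=
  (site_vertex e.1, bond_direction e.2).

Lemma bond_edge1 e : endpoint1 (bond_edge e) = site_vertex (bond1 e).
Proof. by []. Qed.

Lemma bond_edge2 e : endpoint2 (bond_edge e) = site_vertex (bond2 e).
Proof.
case: e => -[a b] dir; apply/rowP => j; rewrite endpoint2E /endpoint1 /= !mxE /=.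
rewrite -(inj_eq val_inj); case: dir => /=;
  by have [j0|j0] := eqVneq (val j) 0%N; have [j1|j1] := eqVneq (val j) 1%N;
    rewrite /bond2 /=; lia.
Qed.

Lemma site_vertex_inj : injective site_vertex.
Proof.
move=> [a b] [a' b'] /rowP h; have := h (Ordinal (ltnW hd)).
by have := h (Ordinal hd); rewrite !mxE /= => b1 a1; congr (_, _); lia.
Qed.

Lemma bond_edge_inj : injective bond_edge.
Proof.
move=> [u b] [v c] [/site_vertex_inj -> bc]; congr (_, _).
by move: bc; case: b; case: c.
Qed.

Definition quadrant_slab : set (vertex d) :=
  [set x | (forall i, 0 <= x 0 i) /\
           (forall i : 'I_d, (2 <= i)%N -> x 0 i <= (4 * n)%:Z)].

Lemma ball_quadrant_slab e :
  ball (centre n (bond_edge e)) (2 * n) `<=` quadrant_slab.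
Proof.
move=> z /rho_leP h; split=> i.
  have := h i; rewrite centreE /= mxE.
  set A := 2 * _ + _; have A2 : 2 <= A.
    by rewrite /A; case: ifP => _; [|case: ifP => _];
      case: (i == bond_direction e.2) => /=; lia.
  have : n%:Z * 2 <= n%:Z * A by apply: ler_wpM2l.
  lia.
move=> i2; have := h i; rewrite centreE /= mxE.
have -> : (i == 0%N :> nat) = false by lia.
have -> : (i == 1%N :> nat) = false by lia.
have -> : (i == bond_direction e.2) = false.
  by apply/negP => /eqP /(congr1 val); case: (e.2) => /=; lia.
lia.
Qed.

Lemma reach_connected (G : set (edge d)) (O : set bond) u v :
  (forall e, O e -> connected_in G (ball (centre n (bond_edge e)) (2 * n))
     (endpoint1 (bond_edge e) *+ (2 * n)) (endpoint2 (bond_edge e) *+ (2 * n))) ->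
  quadrant_reach O u v ->
  connected_in G quadrant_slab (site_vertex u *+ (2 * n)) (site_vertex v *+ (2 * n)).
Proof.
move=> OG; elim=> [|e Oe _ IH|e Oe _ IH].
- apply: connected_in_refl; split=> i; rewrite mulmxnE mxE.
    by apply: mulrn_wge0; case: ifP => // _; case: ifP.
  move=> i2; have -> : (i == 0%N :> nat) = false by lia.
  have -> : (i == 1%N :> nat) = false by lia.
  by rewrite natz; lia.
- apply: connected_in_trans IH _; rewrite -bond_edge1 -bond_edge2.
  by apply: connected_in_sub (OG e Oe) => //; exact: ball_quadrant_slab.
- apply: connected_in_trans IH _; rewrite -bond_edge1 -bond_edge2.
  apply: connected_in_sym.
  by apply: connected_in_sub (OG e Oe) => //; exact: ball_quadrant_slab.
Qed.

Lemma reach_percolates (G : set (edge d)) (O : set bond) u :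
  (0 < n)%N ->
  (forall e, O e -> connected_in G (ball (centre n (bond_edge e)) (2 * n))
     (endpoint1 (bond_edge e) *+ (2 * n)) (endpoint2 (bond_edge e) *+ (2 * n))) ->
  infinite_set [set v | quadrant_reach O u v] -> percolates_in G quadrant_slab.
Proof.
move=> n0 OG inf.
have uu := reach_connected OG (reach_refl O u).
exists (site_vertex u *+ (2 * n)); first exact: (connected_in_ends uu).1.
move=> fin; apply: inf.
pose f v := site_vertex v *+ (2 * n).
have fI : injective f.
  move=> v v' /rowP h; apply: site_vertex_inj; apply/rowP => j.
  by have := h j; rewrite !mulmxnE => /(pmulrnI _); apply; lia.
apply: (@sub_finite_set _ _ (f @^-1` (cluster G quadrant_slab (f u)))).
  by move=> v uv; exact: reach_connected uv.
by apply: finite_preimage => // v v' _ _; exact: fI.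
Qed.
End quadrant_embedding.

Lemma measurable_percolates_in (disp : measure_display) (T : measurableType disp)
    (d : nat) (G : T -> set (edge d)) (S : set (vertex d)) :
  random_set G -> measurable [set w | percolates_in (G w) S].
Proof.
move=> mG.
rewrite (_ : [set _ | _] = [set w | exists x, S x /\
   forall A : {fset vertex d}, exists y, ~ (y \in A) /\ connected_in (G w) S x y]).
  apply: measurable_exists => x; apply: measurable_conj; first exact: measurable_cst.
  apply: measurable_forall => A; apply: measurable_exists => y.
  apply: measurable_conj; first exact: measurable_cst.
  exact: measurable_connected_in.
apply/seteqP; split=> w.
  move=> [x Sx inf]; exists x; split => // A; apply: contrapT => none; apply: inf.
  apply: (@sub_finite_set _ _ [set` A]); last exact: finite_fset.
  by move=> y xy; apply: contrapT => nA; apply: none; exists y.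
move=> [x [Sx h]]; exists x => // fin; have [y [yA xy]] := h (fset_set (cluster (G w) S x)).
by apply: yA; rewrite in_fset_set //; exact/mem_set.
Qed.

Lemma percolates_in_sub (d : nat) (G G' : set (edge d)) (S S' : set (vertex d)) :
  G `<=` G' -> S `<=` S' -> percolates_in G S -> percolates_in G' S'.
Proof.
move=> GG SS [x Sx inf]; exists x; first exact: SS.
move=> fin; apply: inf; apply: sub_finite_set fin => y.
by apply: connected_in_sub => // e _ _; exact: GG.
Qed.

Lemma random_joint_graph (d : nat) (X : set (edge d)) (disp : measure_display)
    (T : measurableType disp) (Z : T -> set (edge d + edge d)%type) :
  random_set Z -> random_set (fun w => joint_graph X (Z w)).
Proof.
move=> mZ f; apply: measurable_conj; last exact: mZ.
exact: (@random_set_setUl _ _ _ (fun w => [set f | Z w (inl f)]) X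
  (fun f => mZ (inl f)) f).
Qed.

(** Percolation is an event of the sigma-algebra of the random set, so its
    probability can be computed in the coupling. *)
Lemma joint_percolation_percolates (R : realType) (d : nat) (hd : (2 <= d)%N)
    (eps : R) : 0 < eps -> eps <= 1 ->
  exists (n : nat) (q : R), 0 <= q < 1 /\
  forall X : set (edge d), everywhere_percolating X ->
  forall (disp : measure_display) (T : measurableType disp)
    (P : probability T R) (Z : T -> set (edge d + edge d)%type),
  joint_percolation P eps q Z ->
  P [set w | percolates_in (joint_graph X (Z w)) (@quadrant_slab d n)] = 1%E.
Proof.
move=> e0 e1.
have p01 : 0 <= 1 - 16^-1 :> R by rewrite subr_ge0 invf_le1 ?ler1n ?ltr0n.
have p11 : 1 - 16^-1 < 1 :> R by rewrite ltrBlDr ltrDl invr_gt0 ltr0n.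
have [|n [q [n0 q01 hn]]] := @coupling R d hd eps (1 - 16^-1) e0 e1; first by rewrite p01.
exists n, q; split => // X perX disp T P Z [mZ pZl pZr iZ].
have [disp1 [T1 [P1 [Z1 [Z' [[mZ1 p1l p1r i1] [mZ' pZ' iZ'] conn]]]]]] := hn X perX.
pose A : set (setspace (edge d + edge d)) :=
  [set S | percolates_in (joint_graph X S) (@quadrant_slab d n)].
have mA : measurable A.
  exact: measurable_percolates_in (random_joint_graph X (@random_set_id _)).
rewrite -[[set w | _]]/(Z @^-1` A).
rewrite (indep_law mZ mZ1 iZ i1) //; last by move=> [f|f]; rewrite ?pZl ?p1l ?pZr ?p1r.
have [N [mN PN hN]] := @quadrant_percolation R disp1 T1 P1
  (fun w => [set e | Z' w (bond_edge hd e)]) (1 - 16^-1)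
  (fun e => mZ' _) (fun e => pZ' _)
  (mutually_independent_inj (@bond_edge_inj d hd) iZ') (lexx _).
have mA1 := random_set_preimage mZ1 mA.
apply/eqP; rewrite eq_le probability_le1 //= -(sube0 1%E) -PN -probability_setC //.
apply: le_measure; rewrite ?inE //; first exact: measurableC.
move=> w /hN[u inf]; apply: reach_percolates inf => // e oe.
exact: conn oe.
Qed.

Lemma joint_percolation_prod (R : realType) (d : nat)
    (disp1 disp2 : measure_display) (T1 : measurableType disp1)
    (T2 : measurableType disp2) (P1 : probability T1 R) (P2 : probability T2 R)
    (omega : T1 -> set (edge d)) (eta : T2 -> set (edge d)) (eps q : R) :
  bernoulli_percolation P1 eps omega -> bernoulli_percolation P2 q eta ->
  joint_percolation (product_prob P1 P2) eps q (fun w => [set i | match i with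
     inl f => omega w.1 f | inr f => eta w.2 f end]).
Proof.
move=> [m1 p1 i1] [m2 p2 i2].
have e1 f : [set w : T1 * T2 | omega w.1 f] = fst @^-1` [set v | omega v f] by [].
have e2 f : [set w : T1 * T2 | eta w.2 f] = snd @^-1` [set v | eta v f] by [].
split.
- move=> [f|f] /=; rewrite ?e1 ?e2.
    exact: (measurable_fst_preimage (m1 f)).
  exact: (measurable_snd_preimage (m2 f)).
- by move=> f; rewrite /= e1 product_prob_fst.
- by move=> f; rewrite /= e2 product_prob_snd.
have := mutually_independent_sum m1 m2 i1 i2.
move=> h J; have := h J.
have E i : [set w : T1 * T2 | match i with
      inl f => omega w.1 f | inr f => eta w.2 f end] =
   match i with inl i => fst @^-1` [set v | omega v i]
     | inr k => snd @^-1` [set v | eta v k] end by case: i.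
under [in X in _ -> X]eq_bigr do rewrite E.
by move=> <-; congr (product_prob P1 P2 _); apply: eq_bigcapr => i _; rewrite E.
Qed.

Lemma ae_probability1 (R : realType) (disp : measure_display)
    (T : measurableType disp) (P : probability T R) (E : set T) :
  measurable E -> P E = 1%E -> {ae P, forall w, E w}.
Proof.
move=> mE PE; exists (~` E); split => //; first exact: measurableC.
by rewrite probability_setC // PE subee.
Qed.

Lemma sprinkled_connected (R : realType) (d : nat) (hd : (2 <= d)%N) (eps : R)
    (X : set (edge d)) (disp : measure_display) (T : measurableType disp)
    (P : probability T R) (omega : T -> set (edge d)) :
  0 < eps -> eps <= 1 -> everywhere_percolating X ->
  bernoulli_percolation P eps omega ->
  {ae P, forall w, connected_graph (X `|` omega w)}.
Proof.
move=> e0 e1 perX bern; have mo : random_set omega by case: bern.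
pose E N := [set w | forall x y, ball (0 : vertex d) N x -> ball 0 N y ->
  connected_in (X `|` omega w) setT x y].
have mE N : measurable (E N).
  apply: measurable_forall => x; apply: measurable_forall => y.
  apply: measurable_impl; first exact: measurable_cst.
  apply: measurable_impl; first exact: measurable_cst.
  by apply: measurable_connected_in; exact: random_set_setUl.
have PE N : P (E N) = 1%E.
  apply/eqP; rewrite eq_le probability_le1 //=.
  apply/lee_addgt0Pr => delta d0.
  have [n Nn hn] := ball_connected hd N e0 e1 d0.
  have [mF PF] := hn X 0 disp T P omega perX bern.
  rewrite -leeBlDr // -EFinB; apply: le_trans PF _.
  apply: le_measure; rewrite ?inE // => w h x y xN yN.
  by apply: connected_in_sub (h x y _ _) => //; rewrite /ball /=;
    [move: xN|move: yN]; rewrite /ball /=; lia.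
have aeE N := ae_probability1 (mE N) (PE N).
apply: negligibleS (negligible_bigcup aeE) => w nw.
apply: contrapT => h; apply: nw => x y.
have Ew N : E N w by apply: contrapT => nE; apply: h; exists N.
apply: (Ew (maxn (rho 0 x) (rho 0 y))); rewrite /ball /= ?leq_maxl //.
exact: leq_maxr.
Qed.

Lemma renormalized_random (disp : measure_display) (T : measurableType disp)
    (d n : nat) (G : T -> set (edge d)) :
  random_set G -> random_set (fun w => renormalized n (G w)).
Proof. by move=> mG e; exact: measurable_connected_in. Qed.

Lemma renormalized_dominates (R : realType) (d : nat) (hd : (2 <= d)%N)
    (eps p : R) (X : set (edge d)) (disp : measure_display)
    (T : measurableType disp) (P : probability T R)
    (omega : T -> set (edge d)) :
  0 < eps -> eps <= 1 -> 0 <= p < 1 -> everywhere_percolating X ->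
  bernoulli_percolation P eps omega ->
  exists2 n : nat, (1 <= n)%N &
  exists (disp' : measure_display) (T' : measurableType disp')
    (P' : probability T' R) (omega' : T' -> set (edge d)),
    bernoulli_percolation P' p omega' /\
    stochastically_dominates P (fun w => renormalized n (X `|` omega w)) P' omega'.
Proof.
move=> e0 e1 p01 perX [mo po io].
have [n [q [n0 q01 hn]]] := coupling hd e0 e1 p01.
exists n => //.
have [disp' [T' [P' [Z [Z' [[mZ pl pr iZ] bern' conn]]]]]] := hn X perX.
exists disp', T', P', Z'; split => //.
pose omega1 w : set (edge d) := [set f | Z w (inl f)].
have mo1 : random_set omega1 by move=> f; exact: mZ.
have io1 : mutually_independent P' (fun e => [set w | omega1 w e]).
  by apply: (mutually_independent_inj (g := fun f => inl f) _ iZ) => f g [].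
have mZ' : random_subgraph Z' by case: bern'.
exists disp', T', P', (fun w => renormalized n (X `|` omega1 w)), Z'.
split.
- split.
  + exact: renormalized_random (random_set_setUl X mo1).
  + exact: renormalized_random (random_set_setUl X mo).
  move=> A mA.
  have mA' : measurable ((fun S : setspace (edge d) =>
      renormalized n (X `|` S)) @^-1` (A : set (setspace (edge d)))).
    apply: random_set_preimage mA; apply: renormalized_random.
    exact: random_set_setUl (@random_set_id _).
  apply: (indep_law mo1 mo io1 io _ mA') => f.
  by rewrite po -[RHS](pl f).
- by split.
apply: (ae_probability1 (E := [set w | Z' w `<=` renormalized n (X `|` omega1 w)])).
  rewrite (_ : [set _ | _] = [set w | forall e, Z' w e ->
     renormalized n (X `|` omega1 w) e]) //.
  apply: measurable_forall => e; apply: measurable_impl; first exact: mZ'.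
  exact: (renormalized_random n (random_set_setUl X mo1) e).
rewrite (_ : [set _ | _] = setT) ?probability_setT //.
apply/seteqP; split=> // w _ e Z'e; rewrite /renormalized /=.
apply: connected_in_sub (conn w e Z'e).
  by move=> z; rewrite /= boxE.
by move=> f _ _ [].
Qed.

Theorem theorem1 (R : realType) (d : nat) (hd : (2 <= d)%N)
    (eps : R) (heps0 : 0 < eps) (heps1 : eps <= 1) :
  exists L : nat,
  forall (X : set (edge d)), everywhere_percolating X ->
  forall (disp : measure_display) (T : measurableType disp)
    (P : probability T R) (omega : T -> set (edge d)),
  bernoulli_percolation P eps omega ->
  let Y := fun w : T => X `|` omega w in
  [/\ {ae P, forall w, connected_graph (Y w)},
      {ae P, forall w, (p_c R (Y w) < 1)%E},
      {ae P, forall w, percolates_in (Y w) (upper_half_space d)},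
      {ae P, forall w, percolates_in (Y w) (slab d L)}
    & forall p : R, 0 <= p < 1 ->
      exists2 n : nat, (1 <= n)%N &
      exists (disp' : measure_display) (T' : measurableType disp')
        (P' : probability T' R) (omega' : T' -> set (edge d)),
        bernoulli_percolation P' p omega' /\
        stochastically_dominates P (fun w => renormalized n (Y w)) P' omega'].
Proof.
have [n [q [q01 hq]]] := joint_percolation_percolates hd heps0 heps1.
exists (4 * n)%N => X perX disp T P omega bern Y.
have [|disp' [T' [P' [eta [meta peta ieta]]]]] :=
  @indep_family_exists R (edge d) (fun=> q).
  by move=> _; case/andP: q01 => -> /ltW.
have bern' : bernoulli_percolation P' q eta by split.
have mo : random_set omega by case: bern.
have joint := joint_percolation_prod bern bern'.
set Z := (fun w : T * T' => _) in joint.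
have mZ : random_set Z by case: joint.
have mE := measurable_percolates_in (@quadrant_slab d n) (random_joint_graph X mZ).
have aeE := product_prob_ae_section mE (hq X perX _ _ _ _ joint).
have sectionE w : xsection [set u | percolates_in (joint_graph X (Z u))
      (@quadrant_slab d n)] w =
    [set v | percolates_in (Y w `&` eta v) (@quadrant_slab d n)].
  by apply/seteqP; split=> v; rewrite /xsection /= inE.
have main (S : set (vertex d)) : @quadrant_slab d n `<=` S ->
    {ae P, forall w, percolates_in (Y w) S}.
  move=> QS; apply: filterS aeE => w; rewrite sectionE => h.
  apply: contrapT => nY; move: h.
  rewrite (_ : [set v | _] = set0) ?measure0.
    by move=> /eqP; rewrite eq_sym onee_eq0.
  apply/seteqP; split=> v //= pv; apply: nY.
  by apply: percolates_in_sub pv => // e [].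
split.
- by have h := sprinkled_connected hd heps0 heps1 perX bern.
- apply: filterS aeE => w; rewrite sectionE => h.
  apply: (@le_lt_trans _ _ q%:E); last by rewrite lte_fin; case/andP: q01.
  apply: ereal_inf_lbound; exists q => //; split.
    by case/andP: q01 => -> /ltW.
  exists disp', T', P', eta; split => //.
  have mG : random_set (fun v => Y w `&` eta v).
    by move=> f; apply: measurable_conj; [exact: measurable_cst|exact: meta].
  apply: (@lt_le_trans _ _ 1%E); first exact: lte01.
  rewrite -h; apply: le_measure; rewrite ?inE.
  + exact: measurable_percolates_in.
  + exact: measurable_percolates_in.
  by move=> v; exact: percolates_in_sub.
- by apply: main => x [x0 _] i _; exact: x0.
- by apply: main => x [x0 x1] i i2; rewrite x0 x1.
- by move=> p p01; have h := renormalized_dominates hd heps0 heps1 p01 perX bern.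
Qed.
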